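(* Let $\Omega\subset\mathbb{R}^n$ be a bounded domain with smooth and strictly convex boundary, let $K$ be a smooth function on an open subset of $\mathbb{R}^n$ containing $\overline\Omega$ with $K\ge k_o$ for some constant $k_o>0$, and let $\varphi$ be a smooth strictly convex function on an open subset of $\mathbb{R}^n$ containing $\overline\Omega$. Let $u$ be a smooth strictly convex function in $\Omega$ solving the Abreu equation $\mathcal{S}(u)=K$ in $\Omega$ with $u=\varphi$, $|\nabla u|=\infty$ and $w=\det(D^2u)^{-1}=0$ on $\partial\Omega$. Then the Legendre transform $f$ of $u$ yields (as a potential function defined on all of $\mathbb{R}^n$) a Kähler metric of scalar curvature $K$ on the complex torus $\mathbb{C}^n/2\pi\sqrt{-1}\,\mathbb{Z}^n$. In particular, if $K$ is constant, one obtains a $T^n$-invariant Kähler metric of constant scalar curvature $K$ on $\mathbb{C}^n/2\pi\sqrt{-1}\,\mathbb{Z}^n$.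
   Context: Coordinates on $\Omega$ are $\xi=(\xi_1,\dots,\xi_n)$. Smooth strictly convex functions have positive definite Hessian; a smooth boundary is strictly convex if all its principal curvatures are positive. For smooth strictly convex $u$ with inverse Hessian $(u^{ij})$, $\mathcal{S}(u)=-\sum_{i,j}\frac{\partial^2u^{ij}}{\partial\xi_i\partial\xi_j}$. The boundary conditions on $u$ are understood as limits as $\xi\in\Omega$ tends to any boundary point. The Legendre transform $f$ of $u$ is the function on $\nabla u(\Omega)$ given by $f(x)=\sum_k\xi_k\frac{\partial u}{\partial\xi_k}-u(\xi)$, where $x=\nabla u(\xi)$. On $\mathbb{C}^n/2\pi\sqrt{-1}\,\mathbb{Z}^n\cong(\mathbb{C}^* )^n$ use coordinates $z_k=x_k+\sqrt{-1}\,\theta_k$; the torus $T^n$ acts by translations in $\theta$. The metric with potential $f$ is $g_{i\bar j}=\frac{\partial^2 f(x)}{\partial z_i\partial\bar z_j}$, with $f$ regarded as a function of $x=\mathrm{Re}\,z$. Scalar curvature is normalized as $-\sum g^{i\bar j}\frac{\partial^2}{\partial z_i\partial\bar z_j}\log\det(g_{k\bar l})$, which equals $-\sum_{i,j}f^{ij}\frac{\partial^2}{\partial x_i\partial x_j}\log\det(f_{kl})$, and ''scalar curvature $K$'' means that at a point with real part $x=\nabla u(\xi)$ it equals $K(\xi)$. *)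

(* Defs.v *)
From HB Require Import structures.
From mathcomp Require Import all_boot all_order all_algebra.
From mathcomp Require Import complex.
From mathcomp Require Import all_classical all_reals all_analysis.

Set Implicit Arguments.
Unset Strict Implicit.
Unset Printing Implicit Defensive.

Import Order.TTheory GRing.Theory Num.Theory.
Import numFieldNormedType.Exports.

Local Open Scope classical_set_scope.
Local Open Scope ring_scope.
Local Open Scope complex_scope.

Section RealCalculus.
Variables (R : realType) (n : nat).
Implicit Types (x v p : 'rV[R]_n) (f u rho : 'rV[R]_n -> R) (U V Omega : set 'rV[R]_n).

Definition dot x v : R := \sum_i x 0 i * v 0 i.

(* The library norm on row vectors is the sup norm, hence a separate
   Euclidean norm. *)
Definition enorm x : R := Num.sqrt (dot x x).

Definition partial (i : 'I_n) f : 'rV[R]_n -> R :=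
  fun x => 'D_(delta_mx 0 i) f x.

Definition partials (s : seq 'I_n) f : 'rV[R]_n -> R := foldr partial f s.

(* Meaningful for open U only, in which case it does not depend on the values
   of f outside U. *)
Definition smooth_on U f :=
  forall s x, U x -> differentiable (partials s f) x.

Definition grad f x : 'rV[R]_n := \row_i partial i f x.

Definition hess f x : 'M[R]_n := \matrix_(i, j) partial i (partial j f) x.

Definition strictly_convex_on U f :=
  forall x, U x -> forall v, v != 0 -> 0 < (v *m hess f x *m v^T) 0 0.

Definition abreu u x : R :=
  - \sum_i \sum_j partial i (partial j (fun y => invmx (hess u y) i j)) x.

Definition boundary Omega : set 'rV[R]_n := closure Omega `\` interior Omega.

Definition bounded_domain Omega :=
  [/\ open Omega, connected Omega, Omega !=set0 & bounded_set Omega].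

Definition local_defining_function Omega p V rho :=
  [/\ open V, V p, smooth_on V rho, (forall x, V x -> grad rho x != 0)
    & Omega `&` V = [set x | rho x < 0] `&` V].

Definition smooth_boundary Omega :=
  forall p, boundary Omega p ->
  exists V rho, local_defining_function Omega p V rho.

(* Outward unit normal field of the level sets of a defining function. *)
Definition unit_normal rho x : 'rV[R]_n := (enorm (grad rho x))^-1 *: grad rho x.

(* Principal curvatures are the eigenvalues of the differential of the outward
   unit normal on the tangent space; with this sign those of a ball of radius
   r equal 1 / r. *)
Definition principal_curvature Omega p (kappa : R) :=
  exists V rho v, [/\ local_defining_function Omega p V rho,
    v != 0, dot v (unit_normal rho p) = 0
    & 'D_v (unit_normal rho) p = kappa *: v].

Definition smooth_strictly_convex_boundary Omega :=
  smooth_boundary Omega /\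
  forall p, boundary Omega p ->
  forall kappa, principal_curvature Omega p kappa -> 0 < kappa.

(* The value is meaningful at x in the image of Omega under grad u, provided
   the right-hand side does not depend on the preimage xi; 0 elsewhere. *)
Definition legendre Omega u x : R :=
  xget 0 [set y | exists xi, [/\ Omega xi, grad u xi = x & y = dot xi x - u xi]].

End RealCalculus.

(* C^n is R^(n + n) with z = row_mx x theta standing for x + i theta, so that
   lshift n k indexes x_k and rshift n k indexes theta_k. *)
Section ComplexCalculus.
Variables (R : realType) (n : nat).
Implicit Types (z w : 'rV[R]_(n + n)) (F : 'rV[R]_(n + n) -> R[i]).
Implicit Types (g : 'rV[R]_(n + n) -> 'M[R[i]]_n).

Definition cpartial (k : 'I_(n + n)) F z : R[i] :=
  partial k (fun w => complex.Re (F w)) z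
    +i* partial k (fun w => complex.Im (F w)) z.

Definition dz (k : 'I_n) F z : R[i] :=
  2^-1 * (cpartial (lshift n k) F z - 'i * cpartial (rshift n k) F z).

Definition dzbar (k : 'I_n) F z : R[i] :=
  2^-1 * (cpartial (lshift n k) F z + 'i * cpartial (rshift n k) F z).

Definition csmooth F :=
  smooth_on [set: 'rV[R]_(n + n)] (fun w => complex.Re (F w)) /\
  smooth_on [set: 'rV[R]_(n + n)] (fun w => complex.Im (F w)).

(* g z i j stands for g_{i \bar j}(z). Tensors on the quotient of C^n by
   2 pi i Z^n are the periodic tensors on C^n. The last two clauses are the
   (2,1) and (1,2) components of d omega = 0, where omega is the
   fundamental form of g. *)
Definition kahler_metric_torus g :=
  (forall i j, csmooth (fun z => g z i j)) /\
  (forall z (m : 'I_n -> int),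
     g (z + row_mx 0 (\row_k (2 * pi * (m k)%:~R))) = g z) /\
  (forall z, (map_mx Num.conj (g z))^T = g z) /\
  (forall z (v : 'rV[R[i]]_n), v != 0 ->
     0 < (v *m g z *m (map_mx Num.conj v)^T) 0 0) /\
  (forall z i j k, dz k (fun w => g w i j) z = dz i (fun w => g w k j) z) /\
  (forall z i j k, dzbar k (fun w => g w i j) z = dzbar j (fun w => g w i k) z).

Definition torus_invariant g :=
  forall z (t : 'rV[R]_n), g (z + row_mx 0 t) = g z.

Definition potential_metric (f : 'rV[R]_n -> R) z : 'M[R[i]]_n :=
  \matrix_(i, j) dz i (dzbar j (fun w => (f (lsubmx w))%:C)) z.

(* The indices of the inverse matrix are swapped because g^{i \bar j} is
   determined by \sum_j g^{i \bar j} g_{k \bar j} = delta_{ik}. The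
   determinant of a Hermitian matrix is real, so taking its real part loses
   nothing. *)
Definition scalar_curvature g z : R[i] :=
  - \sum_i \sum_j invmx (g z) j i *
      dz i (dzbar j (fun w => (ln (complex.Re (\det (g w))))%:C)) z.

End ComplexCalculus.

(* Main.v *)
(** Positive principal curvatures make [Omega] convex, so [grad u] is strictly
    monotone, hence injective, on [Omega].  Its range is open, because
    [u xi - xi . x] has an interior minimum on small balls for [x] close to a
    value of the gradient, and closed, because [Omega] is bounded and
    [|grad u|] blows up at the boundary; so [grad u] is a bijection onto [R^n].
    Its inverse [G] is differentiable with Jacobian [(D^2 u)^-1 o G], which
    bootstraps to smoothness.  The Legendre transform [f] satisfies
    [grad f = G] and [D^2 f = (D^2 u)^-1 o G], and Jacobi's formula gives
    [d_j log det D^2 f = (\sum_k d_k u^jk) o G]; a second differentiation turns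
    [\sum f^ij d_i d_j log det D^2 f] into [(\sum d_i d_j u^ij) o G], that is,
    the scalar curvature of [f] at [grad u xi] into the Abreu operator of [u]
    at [xi].  For a potential [f (Re z)], [d/dz] and [d/dzbar] are both half
    of [d/dx]. *)

From HB Require Import structures.
Require Import Defs.
From mathcomp Require Import all_boot all_order all_algebra.
From mathcomp Require Import complex perm.
From mathcomp Require Import all_classical all_reals all_analysis.
From mathcomp Require Import ring lra.

Set Implicit Arguments.
Unset Strict Implicit.
Unset Printing Implicit Defensive.

Import Order.TTheory GRing.Theory Num.Theory.
Import numFieldNormedType.Exports.

Local Open Scope classical_set_scope.
Local Open Scope ring_scope.
Local Open Scope complex_scope.

(** * Smooth functions *)

Section Calculus.
Variables (R : realType) (n : nat).
Implicit Types (i j : 'I_n) (x y v : 'rV[R]_n) (f g : 'rV[R]_n -> R) (U : set 'rV[R]_n).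

(** The curvature hypothesis speaks only of eigenvalues of the differential of the unit normal.
    Minimizing a Rayleigh quotient turns it into positivity of the Hessian of a defining function on
    the whole tangent space, which is the form that a second-order argument along a segment can
    contradict. The derivative of [G] comes from a direct perturbation estimate: local surjectivity
    and injectivity of [grad u] give continuity of [G], and invertibility of the Hessian upgrades
    it. Smoothness of every order then rests on one closure property: a partial derivative of
    [phi \o G] is again of the form [psi \o G] with [psi] smooth on [Omega]. The two halves in [dz]
    and [dzbar] make the metric a quarter of the Hessian of [f]; this quarter cancels in the scalar
    curvature against the one produced by differentiating the logarithm. *)

Lemma dotDl x y v : dot (x + y) v = dot x v + dot y v.
Proof. by rewrite /dot -big_split /=; apply: eq_bigr => i _; rewrite mxE mulrDl. Qed.

Lemma dotZl a x v : dot (a *: x) v = a * dot x v.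
Proof. by rewrite /dot mulr_sumr; apply: eq_bigr => i _; rewrite mxE mulrA. Qed.

Lemma dotC x v : dot x v = dot v x.
Proof. by apply: eq_bigr => i _; rewrite mulrC. Qed.

Lemma dotDr x y v : dot v (x + y) = dot v x + dot v y.
Proof. by rewrite dotC dotDl !(dotC v). Qed.

Lemma dotZr a x v : dot v (a *: x) = a * dot v x.
Proof. by rewrite dotC dotZl dotC. Qed.

Lemma dotNl x v : dot (- x) v = - dot x v.
Proof. by rewrite -scaleN1r dotZl mulN1r. Qed.

Lemma dotNr x v : dot v (- x) = - dot v x.
Proof. by rewrite dotC dotNl dotC. Qed.

Lemma dot_delta i v : dot (delta_mx 0 i) v = v 0 i.
Proof.
rewrite /dot (bigD1 i) //= big1 => [|j ji]; rewrite !mxE ?eqxx ?mul1r ?addr0 //.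
by rewrite (negbTE ji) andbF mul0r.
Qed.

Lemma coord_norm x i : `|x 0 i| <= `|x|.
Proof.
rewrite [leRHS]/Num.Def.normr /= mx_normrE.
exact: (le_bigmax _ (fun ij => `|x ij.1 ij.2|) (0, i)).
Qed.

Lemma norm_le_coord x e : 0 <= e -> (forall i, `|x 0 i| <= e) -> `|x| <= e.
Proof.
move=> e0 H; rewrite /Num.Def.normr /= mx_normrE; apply: bigmax_le => //= -[i j] _.
by rewrite (ord1 i) /=.
Qed.

Lemma dot_norm x v : `|dot x v| <= n%:R * `|v| * `|x|.
Proof.
apply: (le_trans (ler_norm_sum _ _ _)).
apply: (@le_trans _ _ (\sum_(i < n) `|v| * `|x|)).
  apply: ler_sum => i _; rewrite normrM mulrC.
  by apply: ler_pM => //; exact: coord_norm.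
by rewrite sumr_const card_ord -mulrA mulr_natl.
Qed.

Lemma nbhs_normP x (A : set 'rV[R]_n) :
  nbhs x A <-> exists2 d : R, 0 < d & forall y, `|y - x| < d -> A y.
Proof.
split=> [/nbhs_ballP[d d0 H]|[d d0 H]].
  by exists d => // y yx; apply: H; rewrite -ball_normE /ball_ /= distrC.
by apply/nbhs_ballP; exists d => // y; rewrite -ball_normE /ball_ /= distrC; exact: H.
Qed.

Lemma continuous_normP f x :
  f @ x --> f x <->
  forall e, 0 < e -> exists2 d : R, 0 < d & forall y, `|y - x| < d -> `|f y - f x| < e.
Proof.
split=> [H e e0|H A /nbhs_ballP[e /= e0 eA]].
  have /H : nbhs (f x) (ball (f x) e) by exact: nbhsx_ballx.
  move=> /nbhs_normP[d d0 dH]; exists d => // y /dH /=.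
  by rewrite -ball_normE /ball_ /= distrC.
apply/nbhs_normP; have [d d0 dH] := H e e0.
by exists d => // y /dH yx; apply: eA; rewrite -ball_normE /ball_ /= distrC.
Qed.

Lemma dot_continuous v : continuous (fun y => dot y v).
Proof.
move=> x; apply/continuous_normP => e e0.
have c0 : 0 < n%:R * `|v| + 1 by rewrite ltr_wpDl // mulr_ge0.
exists (e / (n%:R * `|v| + 1)) => [|y]; first by rewrite divr_gt0.
rewrite ltr_pdivlMr // => H; rewrite -dotNl -dotDl.
apply: (le_lt_trans (dot_norm _ _)); apply: le_lt_trans H.
by rewrite mulrC ler_wpM2l // lerDl.
Qed.

(** An estimate naming the candidate gradient [a] identifies the differential by uniqueness, once
    [dot] with [a] is packed as a continuous linear map. The differentiability of the inverse
    gradient map is reduced to such an estimate. *)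
Lemma differentiable_dotW f x a :
  (forall e, 0 < e -> \forall h \near (0 : 'rV[R]_n),
     `|f (h + x) - f x - dot h a| <= e * `|h|) ->
  differentiable f x /\ forall v, 'D_v f x = dot v a.
Proof.
move=> H.
have linL : linear_for *:%R (fun y : 'rV[R]_n => dot y a : R^o).
  by move=> k y z; rewrite dotDl dotZl.
pose L : {linear 'rV[R]_n -> R^o} :=
  HB.pack (fun y : 'rV[R]_n => dot y a : R^o) (GRing.isLinear.Build _ _ _ _ _ linL).
have Lc : continuous L by exact: dot_continuous.
have Lo : f \o shift x = cst (f x) + L +o_ (0 : 'rV[R]_n) id.
  apply/eqaddoP => e e0; near=> h.
  rewrite -![(_ + _ : _ -> _) _]/(_ + _) -![(- _ : _ -> _) _]/(- _) /= opprD addrA.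
  near: h; exact: H.
have dfE := diff_unique Lc Lo.
have df : differentiable f x.
  by apply/diff_locallyP; rewrite dfE.
by split => // v; rewrite deriveE // dfE.
Unshelve. all: by end_near. Qed.

Lemma derive_dot f x v : differentiable f x -> 'D_v f x = dot v (grad f x).
Proof.
move=> df; rewrite deriveE // {1}(row_sum_delta v) linear_sum.
by apply: eq_bigr => i _; rewrite linearZ /= mxE /partial deriveE.
Qed.

Lemma differentiable_dot f x : differentiable f x ->
  forall e, 0 < e -> \forall h \near (0 : 'rV[R]_n),
     `|f (h + x) - f x - dot h (grad f x)| <= e * `|h|.
Proof.
move=> df e e0; have /eqaddoP/(_ e e0) := diff_locally df.
apply: filterS => h /=.
rewrite -![(_ + _ : _ -> _) _]/(_ + _) -![(- _ : _ -> _) _]/(- _) /=.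
by rewrite opprD addrA -(deriveE _ df) derive_dot.
Qed.

Lemma near_eq_differentiable f g x :
  (\forall y \near x, f y = g y) -> differentiable f x -> differentiable g x.
Proof.
move=> fg df; apply: (proj1 (@differentiable_dotW g x (grad f x) _)) => e e0.
have fgx := nbhs_singleton fg.
have H := differentiable_dot df e0.
have fg0 : \forall h \near (0 : 'rV[R]_n), f (h + x) = g (h + x).
  have := fg; rewrite (near_shift 0) /= subr0; apply: filterS => h /=.
  by [].
near=> h; rewrite -fgx -(near fg0 h) //; near: h; exact: H.
Unshelve. all: by end_near. Qed.

(* [k] times differentiable with differentiable partials of order at most [k];
   the recursion peels off the innermost derivative, unlike [partials]. *)
Fixpoint Ck k U f := (forall x, U x -> differentiable f x) /\
  if k is k'.+1 then forall i, Ck k' U (partial i f) else True.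

Lemma smooth_onP U f : smooth_on U f <-> forall k, Ck k U f.
Proof.
split.
  move=> sf k; elim: k f sf => [|k IH] f sf /=; first by split=> // x; exact: (sf [::]).
  split=> [x|i]; first exact: (sf [::]).
  apply: IH => s x Ux; have := sf (rcons s i) x Ux.
  by rewrite /partials foldr_rcons.
move=> H s x Ux; move: (H (size s)) => {H}.
elim/last_ind: s f => [f [+ _]|s i IH f]; first exact.
by rewrite size_rcons /= => -[_ /(_ i)/IH]; rewrite /partials foldr_rcons.
Qed.

Lemma eq_partial U f g i x : open U -> U x -> (forall y, U y -> f y = g y) ->
  partial i f x = partial i g x.
Proof.
move=> oU Ux fg; apply: near_eq_derive; have := open_nbhs_nbhs (conj oU Ux).
by apply: filterS => y /fg.
Qed.

Lemma Ck_ext k U f g : open U -> (forall y, U y -> f y = g y) ->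
  Ck k U f -> Ck k U g.
Proof.
move=> oU; elim: k f g => [|k IH] f g fg [df H]; split => //.
- move=> x Ux; apply: near_eq_differentiable (df x Ux).
  by have := open_nbhs_nbhs (conj oU Ux); apply: filterS => y /fg.
- move=> x Ux; apply: near_eq_differentiable (df x Ux).
  by have := open_nbhs_nbhs (conj oU Ux); apply: filterS => y /fg.
- move=> i; apply: IH (H i) => y Uy; exact: (eq_partial _ oU).
Qed.

Lemma CkS k U f : Ck k.+1 U f -> Ck k U f.
Proof.
elim: k f => [|k IH] f /=; first by case.
by case=> df H; split => // i; apply: IH; exact: H.
Qed.

Lemma partial_cst i (c : R) : partial i (fun _ => c) = fun _ => 0.
Proof. by apply/funext => x; rewrite /partial derive_cst. Qed.

Lemma Ck_cst k U (c : R) : Ck k U (fun _ => c).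
Proof.
elim: k c => [|k IH] c; split => //; try by move=> x _; exact: differentiable_cst.
by move=> i; rewrite partial_cst.
Qed.

Lemma partialD i f g x : differentiable f x -> differentiable g x ->
  partial i (fun y => f y + g y) x = partial i f x + partial i g x.
Proof. by move=> df dg; rewrite /partial deriveD //; exact: diff_derivable. Qed.

Lemma partialM i f g x : differentiable f x -> differentiable g x ->
  partial i (fun y => f y * g y) x = f x * partial i g x + g x * partial i f x.
Proof.
by move=> df dg; rewrite /partial (@deriveM _ _ f g) //; exact: diff_derivable.
Qed.

Lemma differentiable_invr f x : differentiable f x -> f x != 0 ->
  differentiable (fun y => (f y)^-1) x.
Proof. by move=> df f0; exact: differentiableV. Qed.

Lemma partialV i f x : differentiable f x -> f x != 0 ->
  partial i (fun y => (f y)^-1) x = - ((f x)^-1 * (f x)^-1 * partial i f x).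
Proof.
move=> df f0; rewrite /partial (@deriveV _ _ f) //; last exact: diff_derivable.
by rewrite expr2 invfM scaleNr.
Qed.

Lemma CkD k U f g : open U -> Ck k U f -> Ck k U g -> Ck k U (fun y => f y + g y).
Proof.
move=> oU; elim: k f g => [|k IH] f g [df Hf] [dg Hg]; split => //.
- by move=> x Ux; apply: differentiableD; [exact: df|exact: dg].
- by move=> x Ux; apply: differentiableD; [exact: df|exact: dg].
- move=> i; apply: (Ck_ext oU _ (IH _ _ (Hf i) (Hg i))) => y Uy.
  by rewrite partialD //; [exact: df|exact: dg].
Qed.

Lemma CkM k U f g : open U -> Ck k U f -> Ck k U g -> Ck k U (fun y => f y * g y).
Proof.
move=> oU; elim: k f g => [|k IH] f g.
  by move=> [df Hf] [dg Hg]; split => // x Ux; apply: differentiableM; [exact: df|exact: dg].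
move=> Cf Cg; have Cf' := CkS Cf; have Cg' := CkS Cg.
case: Cf => df Hf; case: Cg => dg Hg; split.
  by move=> x Ux; apply: differentiableM; [exact: df|exact: dg].
move=> i; apply: (Ck_ext oU _ (CkD oU (IH _ _ Cf' (Hg i)) (IH _ _ Cg' (Hf i)))) => y Uy.
by rewrite partialM //; [exact: df|exact: dg].
Qed.

Lemma CkV k U f : open U -> (forall x, U x -> f x != 0) -> Ck k U f ->
  Ck k U (fun y => (f y)^-1).
Proof.
move=> oU f0; elim: k => [|k IH].
  by case=> df _; split => // x Ux; apply: differentiable_invr => //; [exact: df|exact: f0].
(* The derivative of the reciprocal contains the reciprocal itself, whose regularity of order [k] is
   the induction hypothesis for the lowered [f]. *)
move=> Cf; have CV := IH (CkS Cf); case: Cf => df Hf; split.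
  by move=> x Ux; apply: differentiable_invr => //; [exact: df|exact: f0].
move=> i.
apply: (Ck_ext oU _ (CkM oU (Ck_cst k U (-1)) (CkM oU (CkM oU CV CV) (Hf i)))) => y Uy.
by rewrite partialV ?mulN1r //; [exact: df|exact: f0].
Qed.

Lemma partial_coord i j x : partial i (fun y => y 0 j) x = (i == j)%:R.
Proof.
have [_ H] : differentiable (fun y : 'rV[R]_n => y 0 j) x /\
    forall v, 'D_v (fun y : 'rV[R]_n => y 0 j) x = dot v (delta_mx 0 j).
  apply: differentiable_dotW => e e0; near=> h.
  by rewrite mxE addrK dotC dot_delta subrr normr0 mulr_ge0 // ltW.
by rewrite /partial H dot_delta mxE eqxx eq_sym.
Unshelve. all: by end_near. Qed.

Lemma Ck_coord k U j : Ck k U (fun y => y 0 j).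
Proof.
case: k => [|k]; split => //; try by move=> x _; exact: differentiable_coord.
move=> i; rewrite (_ : partial _ _ = fun _ => (i == j)%:R); first exact: Ck_cst.
by apply/funext => x; rewrite partial_coord.
Qed.

Lemma smooth_ext U f g : open U -> (forall y, U y -> f y = g y) ->
  smooth_on U f -> smooth_on U g.
Proof. by move=> oU fg /smooth_onP H; apply/smooth_onP => k; exact: Ck_ext (H k). Qed.

Lemma smooth_cst U (c : R) : smooth_on U (fun _ => c).
Proof. by apply/smooth_onP => k; exact: Ck_cst. Qed.

Lemma smooth_coord U j : smooth_on U (fun y => y 0 j).
Proof. by apply/smooth_onP => k; exact: Ck_coord. Qed.

Lemma smoothD U f g : open U -> smooth_on U f -> smooth_on U g ->
  smooth_on U (fun y => f y + g y).
Proof. by move=> oU /smooth_onP H /smooth_onP H'; apply/smooth_onP => k; exact: CkD. Qed.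

Lemma smoothM U f g : open U -> smooth_on U f -> smooth_on U g ->
  smooth_on U (fun y => f y * g y).
Proof. by move=> oU /smooth_onP H /smooth_onP H'; apply/smooth_onP => k; exact: CkM. Qed.

Lemma smoothV U f : open U -> (forall x, U x -> f x != 0) -> smooth_on U f ->
  smooth_on U (fun y => (f y)^-1).
Proof. by move=> oU f0 /smooth_onP H; apply/smooth_onP => k; exact: CkV. Qed.

Lemma smooth_sum U (I : Type) (r : seq I) (P : pred I) (F : I -> 'rV[R]_n -> R) :
  open U -> (forall i : I, P i -> smooth_on U (F i)) ->
  smooth_on U (fun y => \sum_(i <- r | P i) F i y).
Proof.
move=> oU H; elim: r => [|i r IH].
  rewrite (_ : (fun _ => _) = fun _ => 0); first exact: smooth_cst.
  by apply/funext => y; rewrite big_nil.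
rewrite (_ : (fun _ => _) =
  fun y => (if P i then F i y else 0) + \sum_(j <- r | P j) F j y).
  apply: smoothD => //; case Pi: (P i); [exact: H|exact: smooth_cst].
by apply/funext => y; rewrite big_cons; case: ifP; rewrite ?add0r.
Qed.

Lemma smooth_prod U (I : Type) (r : seq I) (P : pred I) (F : I -> 'rV[R]_n -> R) :
  open U -> (forall i : I, P i -> smooth_on U (F i)) ->
  smooth_on U (fun y => \prod_(i <- r | P i) F i y).
Proof.
move=> oU H; elim: r => [|i r IH].
  rewrite (_ : (fun _ => _) = fun _ => 1); first exact: smooth_cst.
  by apply/funext => y; rewrite big_nil.
rewrite (_ : (fun _ => _) =
  fun y => (if P i then F i y else 1) * \prod_(j <- r | P j) F j y).
  apply: smoothM => //; case Pi: (P i); [exact: H|exact: smooth_cst].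
by apply/funext => y; rewrite big_cons; case: ifP; rewrite ?mul1r.
Qed.

Lemma smooth_partial U f i : smooth_on U f -> smooth_on U (partial i f).
Proof. by move=> sf s x Ux; have := sf (rcons s i) x Ux; rewrite /partials foldr_rcons. Qed.

Lemma smooth_differentiable U f x : smooth_on U f -> U x -> differentiable f x.
Proof. by move=> sf; exact: (sf [::]). Qed.

Lemma is_derive_line f x v (t : R) : differentiable f (x + t *: v) ->
  is_derive t 1 (fun s => f (x + s *: v)) ('D_v f (x + t *: v)).
Proof.
move=> /(@diff_derivable _ _ _ _ _ v) H.
have E : (fun h : R => h^-1 *: (((fun s : R => f (x + s *: v)) \o shift t) (h *: (1:R)) - f (x + t *: v)))
  = (fun h : R => h^-1 *: ((f \o shift (x + t *: v)) (h *: v) - f (x + t *: v))).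
  apply/funext => h /=; congr (_ *: (f _ - _)).
  by rewrite /shift /= [h *: 1]mulr1 scalerDl addrCA.
by split; rewrite /derivable /derive E.
Qed.

End Calculus.

(** * Second derivatives and matrix-valued functions *)

Section Schwarz.
Variables (R : realType) (n : nat).
Implicit Types (i j k : 'I_n) (x y v : 'rV[R]_n) (f g : 'rV[R]_n -> R) (U : set 'rV[R]_n).

Lemma MVT_line f x v (h : R) : 0 < h ->
  (forall t, 0 <= t <= h -> differentiable f (x + t *: v)) ->
  exists2 t, 0 < t < h & f (x + h *: v) - f x = h * 'D_v f (x + t *: v).
Proof.
move=> h0 df.
pose phi (s : R) := f (x + s *: v).
have dphi t : 0 <= t <= h -> is_derive t 1 phi ('D_v f (x + t *: v)).
  by move=> /df; exact: is_derive_line.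
have [||t th] := @MVT R phi (fun t => 'D_v f (x + t *: v)) 0 h h0.
- by move=> t; rewrite in_itv /= => /andP[/ltW t0 /ltW th]; apply: dphi; rewrite t0 th.
- apply: derivable_within_continuous => t; rewrite in_itv /= => th.
  by have [] := dphi _ th.
by rewrite /phi scale0r addr0 subr0 mulrC => E; exists t.
Qed.

Lemma partial_shift i f a x : partial i (fun y => f (y + a)) x = partial i f (x + a).
Proof.
rewrite /partial /derive; set F := fun h : R => _; set G := fun h : R => _.
suff -> : F = G by [].
by apply/funext => h; rewrite /F /G /shift /= addrA.
Qed.

Lemma differentiable_shift f a x :
  differentiable f (x + a) -> differentiable (fun y => f (y + a)) x.
Proof.
move=> df; apply: (@differentiable_comp _ _ _ _ (fun y => y + a) f).
  by apply: differentiableD; [exact: ex_diff|exact: differentiable_cst].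
exact: df.
Qed.

(** The mean value theorem is applied twice, to the increment of [f] along [delta_mx 0 j] and then
    to [partial i f]. Up to reordering, the left side is symmetric in [i] and [j], which forces the
    mixed derivatives to agree. *)
Lemma second_difference U f x i j (h : R) : 0 < h -> smooth_on U f ->
  (forall s t, 0 <= s <= h -> 0 <= t <= h ->
     U (x + s *: delta_mx 0 i + t *: delta_mx 0 j)) ->
  exists s t, [/\ 0 <= s <= h, 0 <= t <= h &
    f (x + h *: delta_mx 0 i + h *: delta_mx 0 j) - f (x + h *: delta_mx 0 i)
      - (f (x + h *: delta_mx 0 j) - f x) =
    h * (h * partial j (partial i f) (x + s *: delta_mx 0 i + t *: delta_mx 0 j))].
Proof.
move=> h0 sf HU.
have wk (t : R) : 0 < t < h -> 0 <= t <= h by move=> /andP[/ltW -> /ltW ->].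
have hh : 0 <= h <= h by rewrite ltW //=.
have h00 : 0 <= (0:R) <= h by rewrite lexx ltW.
pose g y := f (y + h *: delta_mx 0 j) - f y.
have d1 s : 0 <= s <= h ->
    differentiable (fun y => f (y + h *: delta_mx 0 j)) (x + s *: delta_mx 0 i).
  by move=> sh; apply/differentiable_shift/(smooth_differentiable sf)/HU.
have d2 s : 0 <= s <= h -> differentiable f (x + s *: delta_mx 0 i).
  move=> sh; apply: (smooth_differentiable sf).
  by rewrite -[X in U X]addr0 -(scale0r (delta_mx 0 j)); exact: HU.
have [|s /wk sh E] := @MVT_line g x (delta_mx 0 i) h h0.
  by move=> t th; apply: differentiableB; [exact: d1|exact: d2].
have Eg : 'D_(delta_mx 0 i) g (x + s *: delta_mx 0 i) =
    partial i f (x + s *: delta_mx 0 i + h *: delta_mx 0 j)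
      - partial i f (x + s *: delta_mx 0 i).
  rewrite -partial_shift /partial -deriveB //.
    by apply: diff_derivable; exact: d1.
  by apply: diff_derivable; exact: d2.
have [|t /wk th E'] := @MVT_line (partial i f) (x + s *: delta_mx 0 i) (delta_mx 0 j) h h0.
  by move=> t th; apply: (smooth_differentiable (smooth_partial i sf)); exact: HU.
by exists s, t; split => //; rewrite -E' -Eg -E /g.
Qed.

Lemma partialC U f x i j : open U -> smooth_on U f -> U x ->
  partial i (partial j f) x = partial j (partial i f) x.
Proof.
move=> oU sf Ux; apply/eqP/negPn/negP => neq.
set A := partial i _ x in neq; set B := partial j _ x in neq.
have e0 : 0 < `|A - B| / 2 by rewrite divr_gt0 // normr_gt0 subr_eq0.
have cont a b : partial a (partial b f) @ x --> partial a (partial b f) x.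
  apply: differentiable_continuous.
  exact: (smooth_differentiable (smooth_partial a (smooth_partial b sf))).
have /continuous_normP/(_ _ e0)[d1 d10 H1] := cont i j.
have /continuous_normP/(_ _ e0)[d2 d20 H2] := cont j i.
have /nbhs_normP[d3 d30 H3] : nbhs x U by exact: open_nbhs_nbhs.
pose d := Num.min d1 (Num.min d2 d3).
have d0 : 0 < d by rewrite !lt_min d10 d20 d30.
(* A third of [d] keeps the whole square of side [h] within sup distance [2 * h < d] of [x]. *)
pose h := d / 3.
have h0 : 0 < h by rewrite divr_gt0.
have close a b s t : 0 <= s <= h -> 0 <= t <= h ->
    `|x + s *: delta_mx 0 a + t *: delta_mx 0 b - x| < d.
  move=> /andP[s0 sh] /andP[t0 th].
  have nd (c : 'I_n) : `|delta_mx 0 c : 'rV[R]_n| <= 1.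
    apply: norm_le_coord => // l; rewrite mxE eqxx /=.
    by case: (_ == _); rewrite ?normr1 ?normr0.
  rewrite -[x + _ + _]addrA [x + _]addrC addrK; apply: (le_lt_trans (ler_normD _ _)).
  rewrite !normrZ !ger0_norm //.
  have : s * `|delta_mx 0 a : 'rV[R]_n| <= h.
    by rewrite -[leRHS]mulr1; apply: ler_pM.
  have : t * `|delta_mx 0 b : 'rV[R]_n| <= h.
    by rewrite -[leRHS]mulr1; apply: ler_pM.
  rewrite /h; move: d0; clear; move=> *; lra.
have inU a b s t : 0 <= s <= h -> 0 <= t <= h ->
    U (x + s *: delta_mx 0 a + t *: delta_mx 0 b).
  move=> sh th; apply: H3; apply: lt_le_trans (close a b s t sh th) _.
  by rewrite !ge_min lexx !orbT.
have [s [t [sh th E]]] := second_difference h0 sf (inU i j).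
have [s' [t' [sh' th' E']]] := second_difference h0 sf (inU j i).
have EE : partial j (partial i f) (x + s *: delta_mx 0 i + t *: delta_mx 0 j) =
     partial i (partial j f) (x + s' *: delta_mx 0 j + t' *: delta_mx 0 i).
  apply: (mulfI (lt0r_neq0 h0)); apply: (mulfI (lt0r_neq0 h0)).
  rewrite -[LHS]E -[RHS]E' (addrAC x (h *: delta_mx 0 j) (h *: delta_mx 0 i)).
  have abel (a b c e : R) : a - b - (c - e) = a - c - (b - e) by ring.
  exact: abel.
have := H1 _ (lt_le_trans (close j i s' t' sh' th') _).
rewrite ge_min lexx -EE => /(_ isT).
have := H2 _ (lt_le_trans (close i j s t sh th) _).
rewrite !ge_min lexx !orbT => /(_ isT).
rewrite -/A -/B; set C := partial j _ _ => h1 h2.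
have : `|A - B| < `|A - B|; last by rewrite ltxx.
rewrite {2}(splitr `|A - B|); apply: le_lt_trans (ltrD h2 h1).
by rewrite [X in _ <= X + _]distrC; exact: ler_distD.
Qed.

End Schwarz.

(** * Derivatives of determinants, logarithms and inverse matrices *)

Section MatrixCalculus.
Variables (R : realType) (n : nat).
Implicit Types (k : 'I_n) (x y v : 'rV[R]_n) (f g : 'rV[R]_n -> R) (U : set 'rV[R]_n).

Lemma posdef_unitmx m (A : 'M[R]_m) :
  (forall v : 'rV[R]_m, v != 0 -> 0 < (v *m A *m v^T) 0 0) -> A \in unitmx.
Proof.
move=> pA; rewrite -row_free_unit -kermx_eq0; apply/negPn/negP => /rowV0Pn[v].
move=> /sub_kermxP vA0 v0; have := pA v v0.
by rewrite vA0 mul0mx mxE ltxx.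
Qed.

(* The determinant has no zero on the segment from the identity matrix to [A]. *)
Lemma posdef_det_gt0 m (A : 'M[R]_m) :
  (forall v : 'rV[R]_m, v != 0 -> 0 < (v *m A *m v^T) 0 0) -> 0 < \det A.
Proof.
move=> pA.
have p1 (v : 'rV[R]_m) : v != 0 -> 0 < (v *m v^T) 0 0.
  move=> v0; rewrite mxE.
  have ge i : true -> 0 <= v 0 i * v^T i 0 by rewrite mxE -expr2 sqr_ge0.
  rewrite lt_neqAle sumr_ge0 // andbT eq_sym psumr_eq0 //.
  apply: contra v0 => /allP H; apply/eqP/rowP => i; rewrite mxE.
  have := H i (mem_index_enum _); rewrite !mxE mulf_eq0 orbb.
  by move/eqP.
(* As a polynomial in the segment parameter, the determinant falls under the polynomial intermediate
   value theorem. It is applied to [- P], which would go from a nonpositive to a nonnegative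
   value. *)
pose P : {poly R} :=
  \det (\matrix_(i, j) ('X * (A i j)%:P + (1 - 'X) * (i == j)%:R%:P)).
have PE t : P.[t] = \det (t *: A + (1 - t) *: 1%:M).
  rewrite /P -horner_evalE -det_map_mx; congr (\det _).
  by apply/matrixP => i j; rewrite !mxE /= horner_evalE !hornerE.
have Pn t : 0 <= t <= 1 -> P.[t] != 0.
  move=> /andP[t0 t1]; rewrite PE -unitfE -unitmxE; apply: posdef_unitmx => v v0.
  rewrite mulmxDr mulmxDl -!scalemxAr -!scalemxAl mulmx1.
  rewrite mxE [X in X + _]mxE [X in _ + X]mxE.
  have := pA v v0; have := p1 v v0; set a := (v *m v^T) 0 0; set b := (_ *m _) 0 0.
  move=> a0 b0; have [->|tn0] := eqVneq t 0; first by rewrite mul0r add0r subr0 mul1r.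
  apply: ltr_pwDl; first by apply: mulr_gt0 => //; rewrite lt0r tn0 t0.
  by apply: mulr_ge0; [rewrite subr_ge0|exact: ltW].
have P0 : P.[0] = 1 by rewrite PE scale0r add0r subr0 scale1r det1.
have P1 : P.[1] = \det A by rewrite PE subrr scale0r addr0 scale1r.
rewrite ltNge -P1; apply/negP => P10.
have [|t t01] := @poly_ivt _ (- P) 0 1 ler01.
  by rewrite !hornerN P0 oppr_le0 ler01 oppr_ge0.
by rewrite /root hornerN oppr_eq0 (negbTE (Pn _ _)).
Qed.

Definition pmx k m p (M : 'rV[R]_n -> 'M[R]_(m, p)) x : 'M[R]_(m, p) :=
  \matrix_(i, j) partial k (fun y => M y i j) x.

Lemma partial_sum (I : Type) (r : seq I) (P : pred I) (F : I -> 'rV[R]_n -> R) k x :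
  (forall i, differentiable (F i) x) ->
  differentiable (fun y => \sum_(i <- r | P i) F i y) x /\
  partial k (fun y => \sum_(i <- r | P i) F i y) x = \sum_(i <- r | P i) partial k (F i) x.
Proof.
move=> dF; elim: r => [|i r [IHd IH]].
  rewrite (_ : (fun _ => _) = fun _ => 0); last by apply/funext => y; rewrite big_nil.
  by rewrite big_nil partial_cst; split => //; exact: differentiable_cst.
rewrite (_ : (fun _ => _) =
  fun y => (if P i then F i y else 0) + \sum_(j <- r | P j) F j y); last first.
  by apply/funext => y; rewrite big_cons; case: ifP; rewrite ?add0r.
have d0 : differentiable (fun y => if P i then F i y else 0) x.
  by case: (P i) => //; exact: differentiable_cst.
split; first exact: differentiableD.
by rewrite partialD // IH big_cons; case: (P i); rewrite ?partial_cst ?add0r.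
Qed.

Lemma differentiable_prod (I : Type) (r : seq I) (F : I -> 'rV[R]_n -> R) x :
  (forall i, differentiable (F i) x) -> differentiable (fun y => \prod_(i <- r) F i y) x.
Proof.
move=> dF; elim: r => [|i r IHd].
  rewrite (_ : (fun _ => _) = fun _ => 1); last by apply/funext => y; rewrite big_nil.
  exact: differentiable_cst.
rewrite (_ : (fun _ => _) = fun y => F i y * \prod_(j <- r) F j y); last first.
  by apply/funext => y; rewrite big_cons.
exact: differentiableM.
Qed.

Lemma partial_prod (I : eqType) (r : seq I) (F : I -> 'rV[R]_n -> R) k x :
  uniq r -> (forall i, differentiable (F i) x) ->
  partial k (fun y => \prod_(i <- r) F i y) x =
  \sum_(i <- r) partial k (F i) x * \prod_(j <- r | j != i) F j x.
Proof.
move=> + dF; elim: r => [_|i r IH /= /andP[ir ur]].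
  rewrite (_ : (fun _ => _) = fun _ => 1); last by apply/funext => y; rewrite big_nil.
  by rewrite big_nil partial_cst.
rewrite (_ : (fun _ => _) = fun y => F i y * \prod_(j <- r) F j y); last first.
  by apply/funext => y; rewrite big_cons.
rewrite partialM //; last exact: differentiable_prod.
rewrite IH // big_cons big_cons eqxx /= addrC [X in X + _]mulrC; congr (_ * _ + _).
  rewrite [LHS]big_seq [RHS]big_seq_cond; apply: eq_bigl => j.
  by case jr: (j \in r) => //=; apply/esym; apply: contraNneq ir => <-.
rewrite mulr_sumr [LHS]big_seq [RHS]big_seq; apply: eq_bigr => j jr.
rewrite big_cons ifT; first by rewrite mulrCA.
by apply: contraNneq ir => ->.
Qed.

(** Jacobi's formula. The Leibniz expansion is differentiated factor by factor and regrouped by the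
    differentiated row; expanding each resulting determinant along that row produces the cofactors
    of [M x]. *)
Lemma partial_det m (M : 'rV[R]_n -> 'M[R]_m) k x :
  (forall i j, differentiable (fun y => M y i j) x) ->
  differentiable (fun y => \det (M y)) x /\
  partial k (fun y => \det (M y)) x = \tr (\adj (M x) *m pmx k M x).
Proof.
move=> dM.
have dp (s : 'S_m) : differentiable (fun y => \prod_i M y i (s i)) x.
  exact: differentiable_prod.
have dsp (s : 'S_m) :
    differentiable (fun y => (-1) ^+ s * \prod_i M y i (s i)) x.
  by apply: differentiableM => //; exact: differentiable_cst.
have [d1 d2] := partial_sum (index_enum _) predT k dsp.
split; first exact: d1.
rewrite [LHS]d2 /mxtrace.
under [RHS]eq_bigr do rewrite mxE.
rewrite exchange_big /=.
pose Mi (i : 'I_m) := \matrix_(a, b) (if a == i then pmx k M x i b else M x a b).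
transitivity (\sum_i \det (Mi i)); last first.
  apply: eq_bigr => i _; rewrite (expand_det_row _ i); apply: eq_bigr => j _.
  rewrite !mxE eqxx mulrC; congr (_ * _); rewrite /cofactor; congr (_ * \det _).
  by apply/matrixP => a b; rewrite !mxE eq_sym (negbTE (neq_lift _ _)).
rewrite exchange_big /=; apply: eq_bigr => s _.
rewrite partialM //.
rewrite partial_cst mulr0 addr0 partial_prod ?index_enum_uniq // -mulr_sumr.
congr (_ * _); apply: eq_bigr => i _; rewrite [RHS](bigD1 i) //=.
rewrite !mxE eqxx; congr (_ * _); apply: eq_bigr => j ji.
by rewrite mxE (negbTE ji).
Qed.

Lemma differentiable_ln (c : R) : 0 < c -> differentiable (@ln R) c.
Proof. by move=> c0; apply/derivable1_diffP; have [] := @is_derive1_ln R _ c0. Qed.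

Lemma differentiable_ln_comp f x : differentiable f x -> 0 < f x ->
  differentiable (fun y => ln (f y)) x.
Proof.
by move=> df f0; apply: (@differentiable_comp _ _ _ _ f (@ln R)) => //; exact: differentiable_ln.
Qed.

Lemma partial_ln f k x : differentiable f x -> 0 < f x ->
  partial k (fun y => ln (f y)) x = (f x)^-1 * partial k f x.
Proof.
move=> df f0.
have [_ El] : is_derive (f x) 1 (@ln R) (f x)^-1 by exact: is_derive1_ln.
have dl := differentiable_ln f0.
have dc : differentiable (@ln R \o f) x by exact: differentiable_ln_comp.
rewrite /partial (_ : (fun y => ln (f y)) = @ln R \o f) // deriveE // diff_comp //=.
rewrite -(deriveE _ df).
rewrite -[X in 'd _ _ X]mulr1 -[_ * 1]/(_ *: (1:R)) linearZ /= -(deriveE _ dl) El.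
by rewrite mulrC.
Qed.

Lemma partial_mulmx m p q (M : 'rV[R]_n -> 'M[R]_(m, p)) (N : 'rV[R]_n -> 'M[R]_(p, q)) k x :
  (forall i j, differentiable (fun y => M y i j) x) ->
  (forall i j, differentiable (fun y => N y i j) x) ->
  pmx k (fun y => M y *m N y) x = pmx k M x *m N x + M x *m pmx k N x.
Proof.
move=> dM dN; apply/matrixP => i j; rewrite !mxE.
rewrite (_ : (fun _ => _) = fun y => \sum_l M y i l * N y l j); last first.
  by apply/funext => y; rewrite mxE.
rewrite (partial_sum _ _ _ _).2; last by move=> l; exact: differentiableM.
rewrite -big_split; apply: eq_bigr => l _ /=; rewrite partialM // !mxE [LHS]addrC.
by congr (_ + _); exact: mulrC.
Qed.

Lemma smooth_det U m (M : 'rV[R]_n -> 'M[R]_m) : open U ->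
  (forall i j, smooth_on U (fun y => M y i j)) -> smooth_on U (fun y => \det (M y)).
Proof.
move=> oU sM; apply: smooth_sum => // s _; apply: smoothM => //.
  exact: smooth_cst.
by apply: smooth_prod.
Qed.

(** Cramer's rule writes each entry as a cofactor over the determinant, so sums, products and one
    reciprocal suffice. *)
Lemma smooth_invmx U m (M : 'rV[R]_n -> 'M[R]_m) i j : open U ->
  (forall i j, smooth_on U (fun y => M y i j)) ->
  (forall x, U x -> M x \in unitmx) -> smooth_on U (fun y => invmx (M y) i j).
Proof.
move=> oU sM uM.
apply: (@smooth_ext _ _ _ (fun y => (\det (M y))^-1 *
  ((-1) ^+ (j + i) * \det (row' j (col' i (M y)))))) => //.
  by move=> y Uy; rewrite /invmx uM // !mxE.
apply: smoothM => //.
  apply: smoothV => //; last exact: smooth_det.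
  by move=> x /uM; rewrite unitmxE unitfE.
apply: smoothM => //; first exact: smooth_cst.
apply: smooth_det => // a b; rewrite (_ : (fun _ => _) = fun y => M y (lift j a) (lift i b)) //.
by apply/funext => y; rewrite !mxE.
Qed.

Lemma pmx_invmx U m (M : 'rV[R]_n -> 'M[R]_m) k x : open U -> U x ->
  (forall i j, smooth_on U (fun y => M y i j)) ->
  (forall x, U x -> M x \in unitmx) ->
  pmx k (fun y => invmx (M y)) x = - (invmx (M x) *m pmx k M x *m invmx (M x)).
Proof.
move=> oU Ux sM uM.
have dM i j := smooth_differentiable (sM i j) Ux.
have dI i j := smooth_differentiable (smooth_invmx i j oU sM uM) Ux.
have : pmx k (fun y => M y *m invmx (M y)) x = 0.
  apply/matrixP => i j; rewrite !mxE.
  rewrite (@eq_partial _ _ U _ (fun _ => (i == j)%:R)) // ?partial_cst //.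
  by move=> y Uy; rewrite mulmxV ?uM // mxE.
rewrite partial_mulmx // => /eqP; rewrite addrC addr_eq0 => /eqP /(congr1 (mulmx (invmx (M x)))).
by rewrite mulKmx ?uM // mulmxN mulmxA.
Qed.

End MatrixCalculus.

(** * Rayleigh quotients *)

Section Rayleigh.
Variables (R : realType) (n : nat).
Implicit Types (x y v w N : 'rV[R]_n) (H : 'M[R]_n).

Lemma dot0l v : dot 0 v = 0.
Proof. by apply: big1 => i _; rewrite mxE mul0r. Qed.

Lemma dot_ge0 v : 0 <= dot v v.
Proof. by apply: sumr_ge0 => i _; rewrite -expr2 sqr_ge0. Qed.

Lemma dot_eq0 v : (dot v v == 0) = (v == 0).
Proof.
apply/eqP/eqP => [/eqP|->]; last exact: dot0l.
rewrite psumr_eq0 => [/allP H|i _]; last by rewrite -expr2 sqr_ge0.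
apply/rowP => i; rewrite mxE; have := H i (mem_index_enum _).
by rewrite mulf_eq0 orbb => /eqP.
Qed.

Lemma dot_gt0 v : v != 0 -> 0 < dot v v.
Proof. by move=> v0; rewrite lt0r dot_eq0 v0 dot_ge0. Qed.

Lemma dotE v w : dot v w = (v *m w^T) 0 0.
Proof. by rewrite [RHS]mxE; apply: eq_bigr => i _; rewrite !mxE. Qed.

Lemma dot_mulmx_tr v w H : dot (v *m H) w = dot v (w *m H^T).
Proof. by rewrite !dotE trmx_mul trmxK mulmxA. Qed.

Lemma smooth_dot (f g : 'rV[R]_n -> 'rV[R]_n) U : open U ->
  (forall i, smooth_on U (fun y => f y 0 i)) ->
  (forall i, smooth_on U (fun y => g y 0 i)) -> smooth_on U (fun y => dot (f y) (g y)).
Proof. by move=> oU sf sg; apply: smooth_sum => // i _; apply: smoothM. Qed.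

Lemma smooth_mulmx (f : 'rV[R]_n -> 'rV[R]_n) H U i : open U ->
  (forall i, smooth_on U (fun y => f y 0 i)) -> smooth_on U (fun y => (f y *m H) 0 i).
Proof.
move=> oU sf; rewrite (_ : (fun _ => _) = fun y => \sum_j f y 0 j * H j i).
  by apply: smooth_sum => // j _; apply: smoothM => //; exact: smooth_cst.
by apply/funext => y; rewrite mxE.
Qed.

Lemma smooth_continuous (f : 'rV[R]_n -> R) : smooth_on setT f -> continuous f.
Proof. by move=> sf x; apply: differentiable_continuous; exact: (smooth_differentiable sf). Qed.

Lemma unit_tangent_compact N : compact [set v | dot v v = 1 /\ dot v N = 0].
Proof.
apply: bounded_closed_compact.
  exists 1; split; first exact: num_real.
  move=> M M1 v [v1 _]; apply: le_trans (ltW M1); apply: norm_le_coord => // i.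
  rewrite -(ler_pXn2r (n := 2)) ?nnegrE // expr1n -normrX ger0_norm ?sqr_ge0 //.
  rewrite -v1 /dot (bigD1 i) //= -expr2 lerDl; apply: sumr_ge0 => j _.
  by rewrite -expr2 sqr_ge0.
rewrite (_ : [set _ | _] = (fun v => dot v v) @^-1` [set 1] `&` (fun v => dot v N) @^-1` [set 0]) //.
apply: closedI; apply: closed_comp; try exact: closed_eq.
- move=> v _; apply: smooth_continuous.
  by apply: smooth_dot => [|i|i]; [exact: openT|exact: smooth_coord|exact: smooth_coord].
- by move=> v _; exact: dot_continuous.
Qed.

(** The test value is [t = - b / c] with some positive [c > a]: the expression becomes
    [- (b ^+ 2 * (c - a)) / c ^+ 2], negative unless [b = 0]. It serves as the first variation at
    the Rayleigh minimizer. *)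
Lemma quadratic_ge0_lin0 (a b : R) : (forall t, 0 <= t * b + t * t * a) -> b = 0.
Proof.
move=> H; apply/eqP/negPn/negP => b0.
pose c := `|a| + 1.
have c0 : 0 < c by rewrite ltr_wpDl.
have ac : a < c by rewrite /c ltr_pwDr // ler_norm.
have := H (- b / c); rewrite leNgt => /negP; apply.
rewrite (_ : _ + _ = - (b ^+ 2 * (c - a)) / c ^+ 2); last by field; rewrite gt_eqF.
rewrite mulNr oppr_lt0 divr_gt0 ?exprn_gt0 // mulr_gt0 ?subr_gt0 //.
by rewrite exprn_even_gt0.
Qed.

(* Lagrange multipliers for the Rayleigh quotient of [H] on the hyperplane
   orthogonal to [N]; [m] is its minimum. *)
Lemma rayleigh_tangent H N v0 : H^T = H -> N != 0 -> v0 != 0 -> dot v0 N = 0 ->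
  dot (v0 *m H) v0 <= 0 ->
  exists v (m a : R), [/\ v != 0, dot v N = 0, m <= 0 & v *m H = m *: v + a *: N].
Proof.
move=> HT N0 v00 v0N q0.
pose q v := dot (v *m H) v.
pose S := [set v | dot v v = 1 /\ dot v N = 0].
have dv0 := dot_gt0 v00.
have nrm w : w != 0 -> dot w N = 0 -> S ((Num.sqrt (dot w w))^-1 *: w).
  move=> w0 wN; have dw := dot_gt0 w0; split; rewrite dotZl ?wN ?mulr0 //.
  rewrite dotZr mulrA -invfM -expr2 sqr_sqrtr ?(ltW dw) // mulVf //.
  by rewrite gt_eqF.
have cq : continuous q.
  apply: smooth_continuous; apply: smooth_dot; first exact: openT.
    by move=> i; apply: smooth_mulmx; [exact: openT|move=> j; exact: smooth_coord].
  by move=> i; exact: smooth_coord.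
have [||v vS vmin] := @EVT_min_rV R n q S _ (@unit_tangent_compact N).
- by exists ((Num.sqrt (dot v0 v0))^-1 *: v0); exact: nrm.
- exact: continuous_subspaceT.
have [v1 vN] : S v by rewrite inE in vS.
have qZ c w : q (c *: w) = c ^+ 2 * q w.
  by rewrite /q -scalemxAl dotZl dotZr mulrA -expr2.
have qmin w : dot w N = 0 -> q v * dot w w <= q w.
  have [->|w0] := eqVneq w 0.
    by move=> _; rewrite {2}/q mul0mx !dot0l mulr0.
  move=> wN; have dw := dot_gt0 w0.
  have := vmin _ (mem_set (nrm w w0 wN)).
  rewrite qZ exprVn sqr_sqrtr ?(ltW dw) //.
  by rewrite ler_pdivlMl // [X in X <= _]mulrC.
have v_neq0 : v != 0 by rewrite -dot_eq0 v1 oner_eq0.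
(* [z] is the residual of the eigenvalue equation. The first variation makes it orthogonal to every
   vector of the hyperplane, so it equals its projection [a *: N]. *)
exists v, (q v); pose z := v *m H - q v *: v; pose a := dot z N / dot N N.
have zT w : dot w N = 0 -> dot z w = 0.
  move=> wN; suff : 2 * dot z w = 0 by move/eqP; rewrite mulf_eq0 pnatr_eq0 /= => /eqP.
  apply: (@quadratic_ge0_lin0 (q w - q v * dot w w)) => t.
  have := qmin (v + t *: w); rewrite dotDl dotZl vN wN mulr0 addr0 => /(_ erefl).
  rewrite -subr_ge0 /z.
  have Es : dot (w *m H) v = dot (v *m H) w by rewrite dot_mulmx_tr HT dotC.
  rewrite /q !mulmxDl -!scalemxAl !(dotDl, dotDr, dotZl, dotZr, dotNl) Es -/(q v) -/(q w) v1.
  by rewrite (dotC w v) => H1; apply: le_trans H1 _; rewrite le_eqVlt; apply/orP; left; apply/eqP; rewrite /q; ring.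
have dN := dot_gt0 N0.
have za : z = a *: N.
  apply/eqP; rewrite -subr_eq0 -dot_eq0.
  have zN : dot (z - a *: N) N = 0.
    by rewrite dotDl dotNl dotZl /a divfK ?subrr // gt_eqF.
  by rewrite {1}dotDl dotNl dotZl zT // (dotC N) zN mulr0 subr0.
exists a; split => //.
  have := qmin v0 v0N; move: q0; rewrite -/(q v0) => h1 h2.
  by have := le_trans h2 h1; rewrite pmulr_lle0.
by rewrite -za /z addrC subrK.
Qed.

End Rayleigh.

(** * Strictly convex boundaries *)

Section StrictlyConvexBoundary.
Variables (R : realType) (n : nat).
Implicit Types (x y v p : 'rV[R]_n) (rho : 'rV[R]_n -> R) (V Omega : set 'rV[R]_n).

Lemma hess_sym V rho x : open V -> smooth_on V rho -> V x -> (hess rho x)^T = hess rho x.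
Proof.
by move=> oV sr Vx; apply/matrixP => i j; rewrite !mxE; exact: (partialC _ _ oV).
Qed.

Lemma derive_partial_hess V rho x v : smooth_on V rho -> V x ->
  forall i, 'D_v (partial i rho) x = (v *m hess rho x) 0 i.
Proof.
move=> sr Vx i; rewrite derive_dot; last exact: (smooth_differentiable (smooth_partial i sr)).
by rewrite mxE; apply: eq_bigr => j _; rewrite !mxE.
Qed.

Lemma enorm_gt0 v : v != 0 -> 0 < enorm v.
Proof. by move=> v0; rewrite sqrtr_gt0 dot_gt0. Qed.

Lemma differentiable_enorm_grad V rho x : open V -> smooth_on V rho -> V x ->
  grad rho x != 0 -> differentiable (fun y => enorm (grad rho y)) x.
Proof.
move=> oV sr Vx g0.
have dd : differentiable (fun y => dot (grad rho y) (grad rho y)) x.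
  apply: (@smooth_differentiable _ _ V) => //; apply: smooth_dot => // i.
    rewrite (_ : (fun _ => _) = partial i rho); first exact: smooth_partial.
    by apply/funext => y; rewrite mxE.
  rewrite (_ : (fun _ => _) = partial i rho); first exact: smooth_partial.
  by apply/funext => y; rewrite mxE.
apply: (@differentiable_comp _ _ _ _ (fun y => dot (grad rho y) (grad rho y)) Num.sqrt) => //.
apply/derivable1_diffP.
by have [] := @is_derive1_sqrt R _ (dot_gt0 g0).
Qed.

(** [b] is the derivative of the inverse length of the gradient. Its value can stay hidden: the
    second clause, obtained by differentiating the constant length of the normal, fixes the normal
    component. *)
Lemma derive_unit_normal V rho p v : open V -> smooth_on V rho -> V p ->
  (forall x, V x -> grad rho x != 0) ->
  exists b : R,
    'D_v (unit_normal rho) p =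
      (enorm (grad rho p))^-1 *: (v *m hess rho p) + b *: grad rho p /\
    dot ('D_v (unit_normal rho) p) (unit_normal rho p) = 0.
Proof.
move=> oV sr Vp g0.
pose c y := (enorm (grad rho y))^-1.
have cp0 y : V y -> enorm (grad rho y) != 0 by move=> Vy; rewrite gt_eqF // enorm_gt0 // g0.
have dc : differentiable c p.
  apply: differentiable_invr; last exact: cp0.
  by apply: (differentiable_enorm_grad oV) => //; exact: g0.
have dpi i : differentiable (partial i rho) p.
  exact: (smooth_differentiable (smooth_partial i sr)).
have nuE i : (fun y => unit_normal rho y 0 i) = fun y => c y * partial i rho y.
  by apply/funext => y; rewrite !mxE.
have dnu i : differentiable (fun y => unit_normal rho y 0 i) p.
  by rewrite nuE; exact: differentiableM.
have der : derivable (unit_normal rho) p v.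
  by apply/derivable_mxP => a i; rewrite (ord1 a); exact: diff_derivable.
have DE i : ('D_v (unit_normal rho) p) 0 i = 'D_v (fun y => unit_normal rho y 0 i) p.
  by rewrite derive_mx // mxE.
exists ('D_v c p); split.
  apply/rowP => i; rewrite DE nuE deriveM ?derive_partial_hess //; last 2 first.
  - exact: diff_derivable.
  - exact: diff_derivable.
  by rewrite (derive_partial_hess _ sr) // !mxE [_ *: 'D_v c p]mulrC.
rewrite /dot; under eq_bigr do rewrite DE derive_dot // /dot mulr_suml.
rewrite exchange_big /=; apply: big1 => k _.
have one : partial k (fun y => \sum_i unit_normal rho y 0 i * unit_normal rho y 0 i) p = 0.
  rewrite (@eq_partial _ _ V _ (fun _ => 1)) ?partial_cst // => y Vy.
  rewrite -[LHS]/(dot _ _) dotZl dotZr mulrA -invfM -expr2 sqr_sqrtr ?dot_ge0 //.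
  by rewrite mulVf // dot_eq0 g0.
have {}one : \sum_i (unit_normal rho p 0 i * partial k (fun y => unit_normal rho y 0 i) p +
    unit_normal rho p 0 i * partial k (fun y => unit_normal rho y 0 i) p) = 0.
  rewrite -[RHS]one (partial_sum _ _ _ _).2; last by move=> i; exact: differentiableM.
  by apply: eq_bigr => i _; rewrite partialM.
suff : 2 * \sum_i v 0 k * (grad (fun y => unit_normal rho y 0 i) p) 0 k * unit_normal rho p 0 i = 0.
  by move/eqP; rewrite mulf_eq0 pnatr_eq0 /= => /eqP.
transitivity (v 0 k * 0); last exact: mulr0.
rewrite -[X in _ = _ * X]one !mulr_sumr; apply: eq_bigr => i _.
by rewrite mxE; ring.
Qed.

(* The minimizer of the Rayleigh quotient is a principal direction. *)
Lemma tangent_hess_gt0 Omega p V rho v :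
  (forall kappa, principal_curvature Omega p kappa -> 0 < kappa) ->
  local_defining_function Omega p V rho ->
  v != 0 -> dot v (grad rho p) = 0 -> 0 < dot (v *m hess rho p) v.
Proof.
move=> curv ld v0 vN; have [oV Vp sr g0 _] := ld.
have N0 := g0 _ Vp.
rewrite ltNge; apply/negP => q0.
have [w [m [a [w0 wN m0 E]]]] := rayleigh_tangent (hess_sym oV sr Vp) N0 v0 vN q0.
have [b [D1 D2]] := derive_unit_normal w oV sr Vp g0.
set c := enorm (grad rho p) in D1.
have c0 : 0 < c by exact: enorm_gt0.
have D1' : 'D_w (unit_normal rho) p = (c^-1 * m) *: w + (c^-1 * a + b) *: grad rho p.
  by rewrite D1 E scalerDr !scalerA -addrA -scalerDl.
(* Both [w] and the derivative of the unit normal are orthogonal to [grad rho p], so the normal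
   coefficient vanishes and [w] is a principal direction of curvature [c^-1 * m], which is not
   positive. *)
have ab : c^-1 * a + b = 0.
  move: D2; rewrite D1' /unit_normal -/c dotZr dotDl !dotZl wN mulr0 add0r => /eqP.
  by rewrite !mulf_eq0 invr_eq0 (gt_eqF c0) dot_eq0 (negbTE N0) orbF /= => /eqP.
have : 0 < c^-1 * m.
  apply: curv; exists V, rho, w; split => //.
    by rewrite dotZr wN mulr0.
  by rewrite D1' ab scale0r addr0.
by rewrite pmulr_rgt0 ?invr_gt0 // ltNge m0.
Qed.

Lemma open_line V p v : open V -> V p ->
  exists2 d : R, 0 < d & forall s : R, `|s| < d -> V (p + s *: v).
Proof.
move=> oV Vp; have /nbhs_normP[e e0 H] : nbhs p V by exact: open_nbhs_nbhs.
have v1 : 0 < `|v| + 1 by rewrite ltr_wpDl.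
exists (e / (`|v| + 1)) => [|s]; first by rewrite divr_gt0.
rewrite ltr_pdivlMr // => se; apply: H; rewrite addrC addKr normrZ.
by apply: le_lt_trans se; rewrite ler_wpM2l // lerDl.
Qed.

Lemma first_order_max V rho p v (d : R) : open V -> smooth_on V rho -> V p -> 0 < d ->
  (forall s : R, `|s| < d -> rho (p + s *: v) <= rho p) -> dot v (grad rho p) = 0.
Proof.
move=> oV sr Vp d0 mx; have [d1 d10 d1V] := open_line v oV Vp.
pose e := Num.min d d1.
have e0 : 0 < e by rewrite lt_min d0 d10.
pose phi s := rho (p + s *: v).
have dphi (s : R) : `|s| < e -> is_derive s 1 phi ('D_v rho (p + s *: v)).
  rewrite lt_min => /andP[_ /d1V Vs]; apply: is_derive_line.
  exact: (smooth_differentiable sr).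
have itvE (s : R) : (s \in `]-e, e[%R) = (`|s| < e) by rewrite in_itv /= ltr_norml.
have : is_derive (0 : R) 1 phi 0.
  apply: (@derive1_at_max _ _ (- e) e).
  - by rewrite (le_trans _ (ltW e0)) // oppr_le0 ltW.
  - by move=> t; rewrite itvE => /dphi[].
  - by rewrite itvE normr0.
  - by move=> t; rewrite itvE /phi scale0r addr0 lt_min => /andP[/mx].
have [|_ E [_]] := dphi 0; first by rewrite normr0.
rewrite E scale0r addr0 derive_dot //; exact: (smooth_differentiable sr).
Qed.

Lemma dot_grad_hess V rho p v : open V -> smooth_on V rho -> V p ->
  differentiable (fun y => dot v (grad rho y)) p /\
  'D_v (fun y => dot v (grad rho y)) p = dot (v *m hess rho p) v.
Proof.
move=> oV sr Vp.
pose g y := \sum_j v 0 j * partial j rho y.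
have gE : (fun y => dot v (grad rho y)) = g.
  by apply/funext => y; apply: eq_bigr => j _; rewrite mxE.
have dj j : differentiable (fun y => v 0 j * partial j rho y) p.
  apply: differentiableM => //.
  exact: (smooth_differentiable (smooth_partial j sr)).
have dg : differentiable g p.
  apply: (@smooth_differentiable _ _ V) => //; apply: smooth_sum => // j _.
  by apply: smoothM => //; [exact: smooth_cst|exact: smooth_partial].
rewrite gE; split => //; rewrite derive_dot // {1}/dot.
transitivity (\sum_i v 0 i * \sum_j v 0 j * partial i (partial j rho) p).
  apply: eq_bigr => i _; rewrite mxE (partial_sum _ _ _ _).2 //; congr (_ * _).
  apply: eq_bigr => j _; rewrite partialM //.
    by rewrite partial_cst mulr0 addr0.
  exact: (smooth_differentiable (smooth_partial j sr)).
rewrite {1}/dot; under [RHS]eq_bigr do rewrite mxE mulr_suml.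
rewrite exchange_big /=; apply: eq_bigr => i _; rewrite mulr_sumr.
by apply: eq_bigr => j _; rewrite !mxE; ring.
Qed.

(** If the quadratic form were positive at [v], the derivative of [rho] along the line, zero at [p]
    by the first-order condition, would be positive just after [p], and the mean value theorem would
    push [rho] above its maximum. *)
Lemma second_order_max V rho p v (d : R) : open V -> smooth_on V rho -> V p -> 0 < d ->
  (forall s : R, `|s| < d -> rho (p + s *: v) <= rho p) -> dot (v *m hess rho p) v <= 0.
Proof.
move=> oV sr Vp d0 mx; have [d1 d10 d1V] := open_line v oV Vp.
pose e := Num.min d d1.
have e0 : 0 < e by rewrite lt_min d0 d10.
have vN := first_order_max oV sr Vp d0 mx.
rewrite leNgt; apply/negP => q0.
pose g y := dot v (grad rho y).
have [dg gq] : differentiable g p /\ dot v (grad g p) = dot (v *m hess rho p) v.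
  by have [dg <-] := dot_grad_hess v oV sr Vp; rewrite derive_dot.
have gp : g p = 0 by [].
set q := dot (v *m _) v in q0 gq.
have v1 : 0 < `|v| + 1 by rewrite ltr_wpDl.
have /nbhs_normP[d2 d20 H2] := differentiable_dot dg (divr_gt0 (divr_gt0 q0 (ltr0n _ 2)) v1).
have gpos (s : R) : 0 < s -> s * (`|v| + 1) < d2 -> 0 < g (p + s *: v).
  move=> s0 sd.
  have := H2 (s *: v); rewrite subr0 normrZ gtr0_norm // => /(_ _).
  rewrite [s *: v + p]addrC gp subr0 dotZl gq.
  have sv : s * `|v| < d2 by apply: le_lt_trans sd; rewrite ler_wpM2l ?lerDl // ltW.
  move=> /(_ sv); rewrite ler_norml => /andP[lo _].
  have up : q / 2 / (`|v| + 1) * (s * `|v|) <= q / 2 * s.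
    rewrite -mulrA ler_wpM2l ?(ltW (divr_gt0 q0 _)) // mulrC ler_pdivrMr //.
    by rewrite ler_wpM2l ?lerDl // ltW.
  have sq : 0 < s * q by exact: mulr_gt0.
  move: lo up sq; set G := g _; set W := _ * (s * _); clear; move=> lo up sq; nra.
pose h := Num.min (e / 2) (d2 / (2 * (`|v| + 1))).
have h0 : 0 < h by rewrite lt_min !divr_gt0 // mulr_gt0.
have he (t : R) : 0 <= t <= h -> `|t| < e.
  move=> /andP[t0 th]; rewrite ger0_norm //; apply: le_lt_trans th _.
  by rewrite gt_min ltr_pdivrMr // ltr_pMr // ltr1n.
have [|t /andP[t0 th] Et] := @MVT_line _ _ rho p v h h0.
  move=> t /he; rewrite lt_min => /andP[_ /d1V Vt].
  exact: (smooth_differentiable sr).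
have the : `|t| < e by apply: he; rewrite !ltW.
have hhe : `|h| < e by apply: he; rewrite lexx ltW.
have := mx h; rewrite (lt_le_trans hhe) ?ge_min ?lexx // => /(_ isT).
rewrite -subr_le0 Et leNgt => /negP; apply.
rewrite mulr_gt0 // derive_dot; last first.
  apply: (smooth_differentiable sr); apply: d1V.
  by apply: lt_le_trans the _; rewrite ge_min lexx orbT.
apply: gpos => //; rewrite -ltr_pdivlMr //; apply: lt_le_trans th _.
rewrite ge_min; apply/orP; right.
rewrite ler_pdivrMr ?mulr_gt0 // mulrA mulrAC divfK ?gt_eqF //.
by rewrite ler_peMr ?ler1n // ltW.
Qed.

End StrictlyConvexBoundary.

(** * From boundary curvature to convexity of the domain *)

Section DomainConvexity.
Variables (R : realType) (n : nat).
Implicit Types (x y v p : 'rV[R]_n) (rho : 'rV[R]_n -> R) (V Omega : set 'rV[R]_n).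

Lemma closure_normP x (A : set 'rV[R]_n) :
  closure A x <-> forall e : R, 0 < e -> exists2 y, A y & `|y - x| < e.
Proof.
split=> [cA e e0|H B /nbhs_normP[d d0 dB]].
  have /cA[y [Ay yx]] : nbhs x [set y | `|y - x| < e] by apply/nbhs_normP; exists e.
  by exists y.
by have [y Ay yx] := H d d0; exists y; split => //; exact: dB.
Qed.

(** A tube argument: each [t] tolerates a perturbation of both the parameter and the endpoint, and
    compactness of the unit interval makes the neighbourhood of [y] uniform in [t]. *)
Lemma segment_open Omega x : open Omega ->
  open [set y | forall t : R, 0 <= t <= 1 -> Omega (x + t *: (y - x))].
Proof.
move=> oO; rewrite openE => y Sy; rewrite /interior.
have /compact_near_coveringP/(_ _ (nbhs y) (fun y' t => Omega (x + t *: (y' - x)))) :=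
  @segment_compact R 0 1.
have nf : Filter (nbhs y) by exact: nbhs_filter.
move=> /(_ nf) H.
have {}H : \forall y' \near y, `[0, 1]%classic `<=` (fun t : R => Omega (x + t *: (y' - x))).
  apply: H => t; rewrite /= in_itv /= => t01.
  have /nbhs_normP[d d0 dH] : nbhs (x + t *: (y - x)) Omega.
    by apply: open_nbhs_nbhs; split => //; exact: Sy.
  pose c := `|y - x| + 1 + `|t|.
  have c0 : 0 < c by rewrite ltr_pwDl // ltr_wpDl.
  exists ([set s : R | `|s - t| < d / (2 * c)],
          [set y' | `|y' - y| < Num.min 1 (d / (2 * c))]).
    have dc0 : 0 < d / (2 * c) by rewrite divr_gt0 // mulr_gt0.
    split; last by apply/nbhs_normP; exists (Num.min 1 (d / (2 * c))) => //; rewrite lt_min ltr01 dc0.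
    by apply/nbhs_ballP; exists (d / (2 * c)) => // s; rewrite /ball /= distrC.
  move=> [s y'] /= [st]; rewrite lt_min => /andP[y1 yd]; apply: dH.
  have -> : x + s *: (y' - x) - (x + t *: (y - x)) =
      (s - t) *: (y' - y) + (s - t) *: (y - x) + t *: (y' - y).
    by apply/rowP => i; rewrite !mxE; ring.
  apply: le_lt_trans (ler_normD _ _) _.
  apply: (@le_lt_trans _ _ ((`|s - t| * `|y' - y| + `|s - t| * `|y - x|) + `|t| * `|y' - y|)).
    by rewrite lerD // ?normrZ // (le_trans (ler_normD _ _)) // !normrZ.
  apply: (@le_lt_trans _ _ (d / (2 * c) * c)).
    rewrite -[X in X + _]mulrDr [leRHS]mulrDr; apply: lerD.
      by apply: ler_pM; rewrite ?addr_ge0 //; [exact: ltW|rewrite addrC lerD2l ltW].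
    by rewrite mulrC ler_wpM2r // ltW.
  rewrite invfM mulrA divfK ?gt_eqF //.
  by rewrite ltr_pdivrMr // ltr_pMr // ltr1n.
by apply: filterS H => y' H t t01; apply: H; rewrite /= in_itv.
Qed.

Lemma segment_limit_closure Omega x y :
  closure [set y | forall t : R, 0 <= t <= 1 -> Omega (x + t *: (y - x))] y ->
  forall t : R, 0 <= t <= 1 -> closure Omega (x + t *: (y - x)).
Proof.
move=> /closure_normP H t /andP[t0 t1]; apply/closure_normP => e e0.
have [y' Sy' yy'] := H e e0; exists (x + t *: (y' - x)); first by apply: Sy'; rewrite t0 t1.
have -> : x + t *: (y' - x) - (x + t *: (y - x)) = t *: (y' - y).
  by apply/rowP => i; rewrite !mxE; ring.
rewrite normrZ ger0_norm //; apply: le_lt_trans yy'.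
by rewrite ler_piMl.
Qed.

(* If a segment in the closure touched the boundary, the defining function would
   have a maximum along it there, against positive curvature. *)
Lemma segment_interior Omega x y (t : R) : open Omega ->
  smooth_strictly_convex_boundary Omega -> x != y -> 0 < t < 1 ->
  (forall s : R, 0 <= s <= 1 -> closure Omega (x + s *: (y - x))) ->
  Omega (x + t *: (y - x)).
Proof.
move=> oO [sb curv] xy /andP[t0 t1] cO.
set p := x + t *: (y - x); set v := y - x.
case: (pselect (Omega p)) => // nOp; exfalso.
have bp : boundary Omega p.
  split; first by apply: cO; rewrite !ltW.
  by move=> ip; apply: nOp; exact: interior_subset ip.
have [V [rho ld]] := sb _ bp; have [oV Vp sr g0 E] := ld.
have v0 : v != 0 by rewrite subr_eq0 eq_sym.
(* [rho] is prescribed only through its negativity set inside [V]. Continuity yields [rho <= 0] on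
   the closure, and since [p] is outside [Omega] this forces [rho p = 0], a maximum along the
   segment. *)
have cle z : V z -> closure Omega z -> rho z <= 0.
  move=> Vz /closure_normP cz; rewrite leNgt; apply/negP => rz.
  have := differentiable_continuous (smooth_differentiable sr Vz).
  move=> /continuous_normP/(_ _ rz)[d d0 dH].
  have /nbhs_normP[d' d'0 dV] : nbhs z V by exact: open_nbhs_nbhs.
  have dd0 : 0 < Num.min d d' by rewrite lt_min d0 d'0.
  have [w Ow] := cz _ dd0; rewrite lt_min => /andP[/dH wz /dV Vw].
  have : (Omega `&` V) w by [].
  rewrite E => -[/= w0 _]; move: wz; rewrite ltr_norml => /andP[+ _].
  by rewrite ltrBrDr addNr ltNge ltW.
have rp : rho p = 0.
  apply/eqP; rewrite eq_le cle //; last by case: bp.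
  rewrite /= leNgt; apply/negP => rp; apply: nOp.
  by have : ([set x | rho x < 0] `&` V) p by []; rewrite -E => -[].
have [d1 d10 d1V] := open_line v oV Vp.
pose d := Num.min d1 (Num.min t (1 - t)).
have d0 : 0 < d by rewrite !lt_min d10 t0 subr_gt0 t1.
have mx (s : R) : `|s| < d -> rho (p + s *: v) <= rho p.
  rewrite !lt_min => /and3P[s1 s2 s3].
  rewrite rp; apply: cle; first exact: d1V.
  rewrite /p -addrA -scalerDl; apply: cO.
  by move: s2 s3; rewrite !ltr_norml => /andP[? ?] /andP[? ?]; apply/andP; split; lra.
have := second_order_max oV sr Vp d0 mx; rewrite leNgt => /negP; apply.
apply: (tangent_hess_gt0 (curv _ bp) ld v0).
exact: (first_order_max oV sr Vp d0 mx).
Qed.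

Definition convex_domain Omega :=
  forall x y, Omega x -> Omega y -> forall t : R, 0 <= t <= 1 -> Omega (x + t *: (y - x)).

(* Tietze-Nakajima: the points visible from [x] form a relatively clopen set. *)
Lemma strictly_convex_boundary_convex Omega : open Omega -> connected Omega ->
  smooth_strictly_convex_boundary Omega -> convex_domain Omega.
Proof.
move=> oO cO sb x y Ox Oy.
pose S := [set y | forall t : R, 0 <= t <= 1 -> Omega (x + t *: (y - x))].
suff H : Omega `&` S = Omega.
  by have [] : (Omega `&` S) y by rewrite H.
apply: cO.
- by exists x; split => // t _; rewrite subrr scaler0 addr0.
- by exists S => //; exact: segment_open.
- exists (closure S); first exact: closed_closure.
  apply/seteqP; split => z [Oz Sz]; split => //; first exact: subset_closure.
  move=> t /andP[t0 t1].
  (* [segment_interior] covers only inner points of a nondegenerate segment; the remaining cases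
     reduce to [x] and [z] themselves. *)
  have [<-|xz] := eqVneq x z; first by rewrite subrr scaler0 addr0.
  have [->|tn0] := eqVneq t 0; first by rewrite scale0r addr0.
  have [->|tn1] := eqVneq t 1; first by rewrite scale1r addrC subrK.
  apply: segment_interior => //.
    by rewrite !lt_neqAle t0 t1 tn1 eq_sym tn0.
  exact: segment_limit_closure.
Qed.

End DomainConvexity.

(** * The gradient map *)

Section GradientMap.
Variables (R : realType) (n : nat).
Implicit Types (x y v a : 'rV[R]_n) (u : 'rV[R]_n -> R) (Omega : set 'rV[R]_n).

(** Along the segment, which convexity keeps in [Omega], the product of [grad u] with the direction
    has the Hessian quadratic form as its derivative. *)
Lemma grad_strictly_monotone Omega u x y : open Omega -> convex_domain Omega ->
  smooth_on Omega u -> strictly_convex_on Omega u -> Omega x -> Omega y -> x != y ->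
  0 < dot (y - x) (grad u y - grad u x).
Proof.
move=> oO cO su scu Ox Oy xy.
have v0 : y - x != 0 by rewrite subr_eq0 eq_sym.
have [t t01|t t01] := @MVT_line _ _ (fun z => dot (y - x) (grad u z)) x (y - x) 1 ltr01.
  by apply: (dot_grad_hess _ oO su _).1; exact: cO.
have Ot : Omega (x + t *: (y - x)).
  by apply: cO => //; case/andP: t01 => /ltW -> /ltW ->.
rewrite scale1r mul1r (addrC x) subrK (dot_grad_hess _ oO su Ot).2.
move=> E; rewrite dotDr dotNr E dotE; exact: scu.
Qed.

Lemma grad_injective Omega u x y : open Omega -> convex_domain Omega ->
  smooth_on Omega u -> strictly_convex_on Omega u -> Omega x -> Omega y ->
  grad u x = grad u y -> x = y.
Proof.
move=> oO cO su scu Ox Oy E; apply/eqP/negPn/negP => xy.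
have := grad_strictly_monotone oO cO su scu Ox Oy xy.
by rewrite E subrr dotC dot0l ltxx.
Qed.

(** The mean value theorem yields the gradient at an inner point of the segment, and monotonicity
    compares it with the gradient at [x]. Strictness provides the gap on spheres that makes
    preimages stable when the slope is perturbed. *)
Lemma strict_support Omega u x y : open Omega -> convex_domain Omega ->
  smooth_on Omega u -> strictly_convex_on Omega u -> Omega x -> Omega y -> x != y ->
  u x + dot (y - x) (grad u x) < u y.
Proof.
move=> oO cO su scu Ox Oy xy.
have [t t01|t t01] := @MVT_line _ _ u x (y - x) 1 ltr01.
  by apply: (smooth_differentiable su); exact: cO.
have [t0 t1] := andP t01.
have Ot : Omega (x + t *: (y - x)).
  by apply: cO => //; rewrite !ltW.
rewrite scale1r mul1r {1}(addrC x) subrK derive_dot; last exact: (smooth_differentiable su).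
move=> E; rewrite addrC -ltrBrDr E -subr_gt0 -dotNr -dotDr.
have xz : x != x + t *: (y - x).
  by rewrite -subr_eq0 opprD addrA subrr add0r oppr_eq0 scaler_eq0 (gt_eqF t0) subr_eq0 eq_sym.
have := grad_strictly_monotone oO cO su scu Ox Ot xz.
by rewrite addrAC subrr add0r dotZl pmulr_rgt0.
Qed.

Lemma closed_ball_compact x (r : R) : compact [set y | `|y - x| <= r].
Proof.
apply: bounded_closed_compact.
  exists (r + `|x|); split; first exact: num_real.
  move=> M rM y /= yx; apply: le_trans (ltW rM).
  by rewrite -[y in leLHS](subrK x) (le_trans (ler_normD _ _)) // lerD2r.
move=> y /closure_normP H /=; rewrite leNgt; apply/negP => ry.
have [|z /= zr zy] := H (`|y - x| - r); first by rewrite subr_gt0.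
have := ler_distD z y x; rewrite leNgt => /negP; apply.
by rewrite (distrC y) (lt_le_trans (ltr_leD zy zr)) // subrK.
Qed.

Lemma sphere_compact x (r : R) : compact [set y | `|y - x| = r].
Proof.
have c : closed [set y | r <= `|y - x|].
  move=> y /closure_normP H /=; rewrite leNgt; apply/negP => ry.
  have [|z /= zr zy] := H (r - `|y - x|); first by rewrite subr_gt0.
  have := ler_distD y z x; rewrite leNgt => /negP; apply.
  by apply: lt_le_trans zr; rewrite -ltrBrDr.
rewrite (_ : [set _ | _] = [set y | `|y - x| <= r] `&` [set y | r <= `|y - x|]).
  by apply: compact_closedI => //; exact: closed_ball_compact.
apply/seteqP; split => y /= => [->|[h1 h2]]; first by rewrite lexx.
by apply/eqP; rewrite eq_le h1 h2.
Qed.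

(* The preimage of [a] is found as a minimizer of [u y - y . a] on a small ball. *)
Lemma grad_locally_onto Omega u x (r : R) : open Omega -> convex_domain Omega ->
  smooth_on Omega u -> strictly_convex_on Omega u -> Omega x -> 0 < r ->
  exists2 d : R, 0 < d & forall a, `|a - grad u x| < d ->
    exists y, [/\ Omega y, `|y - x| < r & grad u y = a].
Proof.
move=> oO cO su scu Ox r0.
wlog rO : r r0 / forall y, `|y - x| <= r -> Omega y.
  move=> W; have /nbhs_normP[e e0 eO] : nbhs x Omega by exact: open_nbhs_nbhs.
  have m0 : 0 < Num.min r (e / 2) by rewrite lt_min r0 divr_gt0.
  have [|d d0 H] := W _ m0.
    move=> y yx; apply: eO; apply: le_lt_trans yx _.
    by rewrite gt_min ltr_pdivrMr // ltr_pMr // ltr1n orbT.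
  exists d => // a /H[y [Oy yx E]]; exists y; split => //.
  by apply: lt_le_trans yx _; rewrite ge_min lexx.
pose h a y := u y - dot y a.
have cu y : Omega y -> u @ y --> u y.
  by move=> Oy; apply: differentiable_continuous; exact: (smooth_differentiable su).
have ch a (A : set 'rV[R]_n) : A `<=` Omega -> {within A, continuous (h a)}.
  move=> AO; apply: continuous_in_subspaceT => y; rewrite inE => /AO Oy.
  apply: (@continuousB R R^o _ u (fun y => dot y a)); first exact: cu.
  exact: dot_continuous.
(* On the sphere, [u] minus its tangent slope exceeds the central value by a uniform gap. In
   dimension 0 the sphere is empty, hence the case distinction and the arbitrary witness [1]. *)
have [mu mu0 Hmu] : exists2 mu : R, 0 < mu &
    forall y, `|y - x| = r -> mu <= h (grad u x) y - h (grad u x) x.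
  case: (pselect ([set y | `|y - x| = r] !=set0)) => [S0|Sn]; last first.
    by exists 1 => // y yr; exfalso; apply: Sn; exists y.
  have [|z zS zmin] := @EVT_min_rV R n (h (grad u x)) _ S0 (@sphere_compact x r).
    by apply: ch => y /= yr; apply: rO; rewrite yr.
  rewrite inE /= in zS.
  exists (h (grad u x) z - h (grad u x) x).
    have zx : x != z.
      by apply/eqP => xz; move: zS; rewrite xz subrr normr0 => r00; rewrite -r00 ltxx in r0.
    have := strict_support oO cO su scu Ox (rO z _) zx; rewrite zS lexx => /(_ isT).
    by rewrite subr_gt0 /h dotDl dotNl => H1; lra.
  by move=> y yr; rewrite lerD2r; apply: zmin; rewrite inE.
(* On the ball, pairing with [a - grad u x] costs at most [n%:R * r] times its sup norm. A slope
   within [mu / (n%:R * r + 1)] therefore cannot close the gap, and the minimizer stays off the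
   sphere. *)
have c0 : 0 < n%:R * r + 1 by rewrite ltr_wpDl // mulr_ge0 // ltW.
exists (mu / (n%:R * r + 1)) => [|a]; first by rewrite divr_gt0.
rewrite ltr_pdivlMr // => ad.
have B0 : [set y | `|y - x| <= r] !=set0 by exists x; rewrite /= subrr normr0 ltW.
have [|z zB zmin] := @EVT_min_rV R n (h a) _ B0 (@closed_ball_compact x r).
  by apply: ch.
rewrite inE /= in zB; have Oz := rO _ zB.
have zr : `|z - x| < r.
  rewrite lt_neqAle zB andbT; apply/eqP => zr.
  have := zmin x; rewrite inE /= subrr normr0 ltW // => /(_ isT).
  have := Hmu _ zr; rewrite /h.
  have := dot_norm (z - x) (a - grad u x); rewrite zr ler_norml => /andP[_].
  rewrite !(dotDl, dotDr, dotNl, dotNr).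
  have : n%:R * `|a - grad u x| * r < mu.
    by apply: le_lt_trans ad; rewrite mulrAC mulrC ler_wpM2l // lerDl.
  lra.
exists z; split => //.
have [d d0 dB] : exists2 d : R, 0 < d & forall y, `|y - z| < d -> `|y - x| <= r.
  exists (r - `|z - x|) => [|y yz]; first by rewrite subr_gt0.
  by apply: le_trans (ler_distD z _ _) _; rewrite -lerBrDr ltW.
(* The first-order condition was proved for maxima, hence the change of sign. *)
have sh : smooth_on Omega (fun y => (-1) * u y + dot y a).
  apply: smoothD => //; first by apply: smoothM => //; exact: smooth_cst.
  by apply: smooth_dot => // i; [exact: smooth_coord|exact: smooth_cst].
apply/rowP => i.
have : dot (delta_mx 0 i) (grad (fun y => (-1) * u y + dot y a) z) = 0.
  have [e e0 eB] := open_line (delta_mx 0 i) oO Oz.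
  apply: (first_order_max oO sh Oz d0) => s sd.
  have := zmin (z + s *: delta_mx 0 i); rewrite inE /= /h => H1.
  suff : u z - dot z a <= u (z + s *: delta_mx 0 i) - dot (z + s *: delta_mx 0 i) a by lra.
  apply: H1; apply: dB; rewrite addrC addKr normrZ.
  apply: le_lt_trans sd; rewrite ler_piMr //.
  apply: norm_le_coord => // l; rewrite mxE eqxx /=.
  by case: (_ == _); rewrite ?normr1 ?normr0.
have du := smooth_differentiable su Oz.
have dd : differentiable (fun y => dot y a) z.
  by apply: (@smooth_differentiable _ _ setT) => //;
     apply: smooth_dot => [|j|j]; [exact: openT|exact: smooth_coord|exact: smooth_cst].
rewrite dot_delta mxE partialD //; last first.
  by apply: differentiableM => //; exact: differentiable_cst.
rewrite partialM // partial_cst mulr0 addr0 (_ : partial i (fun y => dot y a) z = a 0 i).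
  by rewrite mxE => H1; lra.
rewrite (partial_sum _ _ _ _).2; last first.
  by move=> j; apply: differentiableM => //; exact: differentiable_coord.
rewrite (bigD1 i) //= big1 ?addr0 => [|j ji]; rewrite partialM ?partial_cst ?partial_coord //.
- by rewrite eqxx mulr0 mulr1 add0r.
- exact: differentiable_coord.
- by rewrite eq_sym (negbTE ji) !mulr0 addr0.
- exact: differentiable_coord.
Qed.

End GradientMap.

(** * Surjectivity of the gradient map and smoothness of its inverse *)

Section GradientOnto.
Variables (R : realType) (n : nat) (Omega : set 'rV[R]_n) (u : 'rV[R]_n -> R).
Hypotheses (oO : open Omega) (cO : convex_domain Omega) (bO : bounded_set Omega).
Hypotheses (O0 : Omega !=set0) (su : smooth_on Omega u) (scu : strictly_convex_on Omega u).
Hypothesis (blowup : forall p, boundary Omega p ->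
  enorm (grad u xi) @[xi --> within Omega (nbhs p)] --> +oo).
Implicit Types (x y v a : 'rV[R]_n).

Lemma bounded_closure (A : set 'rV[R]_n) : bounded_set A -> bounded_set (closure A).
Proof.
move=> [M [_ HM]]; exists (M + 1); split; first exact: num_real.
move=> K MK x /closure_normP/(_ _ (ltr01))[y Ay yx].
have My : `|y| <= K - 1 by apply: HM => //; rewrite ltrBrDr.
have : `|x| <= `|y| + `|y - x|.
  by rewrite -[x in leLHS](subrK y) addrC (le_trans (ler_normD _ _)) // (distrC x).
move=> h; apply: le_trans h _; rewrite -(subrK 1 K) lerD // ltW //.
Qed.

Lemma enorm_le_norm v (M : R) : `|v| <= M -> enorm v <= Num.sqrt (n%:R * M ^+ 2).
Proof.
move=> vM; apply: ler_wsqrtr; rewrite /dot mulr_natl -[in leRHS](card_ord n) -sumr_const.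
apply: ler_sum => i _; rewrite -expr2 -(real_normK (num_real (v 0 i))).
by rewrite lerXn2r ?nnegrE // ?(le_trans (coord_norm v i)) // (le_trans _ vM).
Qed.

Lemma grad_continuous x : Omega x -> forall e : R, 0 < e ->
  exists2 d : R, 0 < d & forall y, `|y - x| < d -> `|grad u y - grad u x| <= e.
Proof.
move=> Ox e e0; apply/nbhs_normP.
have : \forall y \near x, forall i, `|(grad u y - grad u x) 0 i| <= e.
  apply: (filter_forall (nbhs_filter x)) => i; apply/nbhs_normP.
  have : partial i u @ x --> partial i u x.
    apply: differentiable_continuous.
    exact: (smooth_differentiable (smooth_partial i su)).
  move=> /continuous_normP/(_ _ e0)[d d0 H]; exists d => // y /H yx.
  by rewrite !mxE ltW.
by apply: filterS => y; apply: norm_le_coord; exact: ltW.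
Qed.

(** For a missed limit value [a], every point of the closure has a neighbourhood where [grad u]
    keeps a positive distance from [a], by continuity inside and by blow-up at the boundary.
    Compactness makes this distance uniform, a contradiction. *)
Lemma grad_range_closed : closed (grad u @` Omega).
Proof.
move=> a /closure_normP ca; case: (pselect ((grad u @` Omega) a)) => // na; exfalso.
have cc : compact (closure Omega).
  by apply: bounded_closed_compact; [exact: bounded_closure|exact: closed_closure].
have local x : closure Omega x -> exists2 de : R * R, 0 < de.1 /\ 0 < de.2 &
    forall y, Omega y -> `|y - x| < de.1 -> de.2 <= `|grad u y - a|.
  move=> cx; case: (pselect (Omega x)) => Ox.
    have ne : grad u x - a != 0.
      by rewrite subr_eq0; apply/eqP => E; apply: na; exists x.
    have e0 : 0 < `|grad u x - a| / 2 by rewrite divr_gt0 // normr_gt0.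
    have [d d0 H] := grad_continuous Ox e0.
    exists (d, `|grad u x - a| / 2) => // y _ /H /= yx.
    have := ler_distD (grad u y) (grad u x) a; rewrite (distrC (grad u x) (grad u y)).
    lra.
  have bx : boundary Omega x by split => // /interior_subset.
  (* Blow-up is stated in the Euclidean norm, distances in the sup norm. The threshold bounds the
     Euclidean norm of any vector within sup distance 1 of [a]. *)
  have /cvgryPgt/(_ (Num.sqrt (n%:R * (`|a| + 1) ^+ 2))) := blowup bx.
  rewrite near_withinE => /nbhs_normP[d d0 H]; exists (d, 1) => //= y Oy /H /(_ Oy).
  move=> big; rewrite leNgt; apply/negP => ya.
  move: big; rewrite ltNge => /negP; apply; apply: enorm_le_norm.
  by rewrite -[grad u y](subrK a) (le_trans (ler_normD _ _)) // addrC lerD2l ltW.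
have /compact_near_coveringP/(_ R (0^'+)%R
  (fun e y => Omega y -> e <= `|grad u y - a|)) := cc.
move=> /(_ _) H.
have {}H : \forall e \near (0 : R)^'+, closure Omega `<=`
    (fun y => Omega y -> e <= `|grad u y - a|).
  apply: H => x /local[[d e] /= [d0 e0] H].
  exists ([set y | `|y - x| < d], [set e' | e' <= e]) => /=.
    by split; [apply/nbhs_normP; exists d | exact: nbhs_right_le].
  by move=> [y e'] /= [yx ee] Oy; apply: le_trans ee _; exact: H.
have [e [e0 He]] : exists e : R, 0 < e /\ closure Omega `<=`
    (fun y => Omega y -> e <= `|grad u y - a|).
  have /(_ _)/filter_ex[e [e0 He]] := filterI (nbhs_right_gt (0 : R)) H.
  by exists e.
have [_ [y Oy <-] ya] := ca e e0.
by have := He y (subset_closure Oy) Oy; rewrite leNgt ya.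
Qed.

Lemma grad_range_open : open (grad u @` Omega).
Proof.
rewrite openE => _ [x Ox <-]; apply/nbhs_normP.
have [d d0 H] := grad_locally_onto oO cO su scu Ox ltr01.
by exists d => // a /H[y [Oy _ <-]]; exists y.
Qed.

Lemma continuous_line a v : continuous (fun t : R => a + t *: v).
Proof.
move=> t; apply: cvgD; first exact: cvg_cst.
by apply: cvgZr_tmp; exact: cvg_id.
Qed.

(** Connectedness is used only on a segment: the parameters at which the line from [a0] to [a] meets
    the range form a nonempty relatively clopen subset of the unit interval. *)
Lemma grad_onto : grad u @` Omega = [set: 'rV[R]_n].
Proof.
apply/seteqP; split => // a _; have [x0 Ox0] := O0.
set a0 := grad u x0.
pose A := (fun t : R => a0 + t *: (a - a0)) @^-1` (grad u @` Omega).
have E : `[0, 1]%classic `&` A = `[0, 1]%classic.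
  apply: (@segment_connected R 0 1).
  - exists 0; split; first by rewrite /= in_itv /= lexx ler01.
    by exists x0 => //; rewrite scale0r addr0.
  - exists A => //; apply: open_comp; last exact: grad_range_open.
    by move=> t _; exact: continuous_line.
  - exists A => //; apply: closed_comp; last exact: grad_range_closed.
    by move=> t _; exact: continuous_line.
have : (`[0, 1]%classic `&` A) 1 by rewrite E /= in_itv /= ler01 lexx.
by move=> [_]; rewrite /A /= scale1r addrC subrK.
Qed.

Lemma grad_inverse : exists G : 'rV[R]_n -> 'rV[R]_n,
  (forall a, Omega (G a) /\ grad u (G a) = a) /\
  (forall x, Omega x -> G (grad u x) = x).
Proof.
have H a : exists x, Omega x /\ grad u x = a.
  have : (grad u @` Omega) a by rewrite grad_onto.
  by move=> [x Ox E]; exists x.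
exists (fun a => sval (cid (H a))).
have HG a := svalP (cid (H a)).
split => // x Ox; have [Og E] := HG (grad u x).
exact: (grad_injective oO cO su scu Og Ox E).
Qed.

Lemma mulmx_lipschitz (A : 'M[R]_n) : exists2 C : R, 0 < C & forall v, `|v *m A| <= C * `|v|.
Proof.
pose C := \sum_j (n%:R * `|(col j A)^T|) + 1.
have s0 : 0 <= \sum_j (n%:R * `|(col j A)^T|) by apply: sumr_ge0 => j _; rewrite mulr_ge0.
exists C => [|v]; first by rewrite ltr_wpDl.
apply: norm_le_coord => [|j]; first by rewrite mulr_ge0 // addr_ge0.
have -> : (v *m A) 0 j = dot v (col j A)^T.
  by rewrite mxE; apply: eq_bigr => i _; rewrite !mxE.
apply: le_trans (dot_norm _ _) _; rewrite ler_wpM2r // /C (bigD1 j) //= -addrA lerDl.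
by rewrite addr_ge0 // sumr_ge0 // => k _; rewrite mulr_ge0.
Qed.

Variable G : 'rV[R]_n -> 'rV[R]_n.
Hypothesis (GO : forall a, Omega (G a) /\ grad u (G a) = a).
Hypothesis (GK : forall x, Omega x -> G (grad u x) = x).

Lemma hess_unit x : Omega x -> hess u x \in unitmx.
Proof. by move=> Ox; apply: posdef_unitmx; exact: scu. Qed.

(** With [k = G (h + a) - G a], differentiability of the gradient gives [h = k *m H + r] with [r]
    small against [k]. Inverting [H] bounds [k] by a multiple of [h], and [r *m Hi] is then the
    linearization error of [G]. *)
Lemma grad_inverse_differentiable a i :
  differentiable (fun b => G b 0 i) a /\
  forall v, 'D_v (fun b => G b 0 i) a = (v *m invmx (hess u (G a))) 0 i.
Proof.
have [Oy Ey] := GO a; set y := G a in Oy Ey *.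
set H := hess u y; set Hi := invmx H.
have uH : H \in unitmx by exact: hess_unit.
have [C C0 HC] := mulmx_lipschitz Hi.
have [dd DE] : differentiable (fun b => G b 0 i) a /\
    forall v, 'D_v (fun b => G b 0 i) a = dot v (col i Hi)^T; last first.
  split => // v; rewrite DE mxE; by apply: eq_bigr => j _; rewrite !mxE.
apply: differentiable_dotW => e e0.
(* The first bound lets the remainder be absorbed, so that [k] has norm at most [2 * C] times that
   of [h]; the second brings the final error below [e] times the norm of [h]. *)
pose e' := Num.min (2^-1 / C) (e / (2 * C * C)).
have CC : 0 < 2 * C * C by rewrite !mulr_gt0.
have e'0 : 0 < e' by rewrite lt_min !divr_gt0.
have /nbhs_normP[d d0 Hd] : \forall k \near (0 : 'rV[R]_n), forall j,
    `|partial j u (k + y) - partial j u y - (k *m H) 0 j| <= e' * `|k|.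
  apply: (@filter_forall _ _ _ _ (nbhs_filter (0 : 'rV[R]_n))) => j.
  have dj : differentiable (partial j u) y.
    exact: (smooth_differentiable (smooth_partial j su)).
  have := differentiable_dot dj e'0; apply: filterS => k.
  by rewrite -derive_dot // (derive_partial_hess _ su).
(* Continuity of [G] enters here: a preimage of [h + a] exists near [y], and [GK] identifies it with
   [G (h + a)]. *)
have [d1 d10 Hd1] := grad_locally_onto oO cO su scu Oy d0.
apply/nbhs_normP; exists d1 => // h; rewrite subr0 => hd1.
have [z [Oz zy Ez]] : exists z, [/\ Omega z, `|z - y| < d & grad u z = h + a].
  by apply: Hd1; rewrite Ey addrK.
have Gz : G (h + a) = z by rewrite -Ez GK.
pose k := z - y; pose r := h - k *m H.
have rE : `|r| <= e' * `|k|.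
  apply: norm_le_coord => [|j]; first by rewrite mulr_ge0 // ltW.
  have := Hd k; rewrite subr0 /k subrK => /(_ zy j).
  suff -> : partial j u z - partial j u y - ((z - y) *m H) 0 j = r 0 j by [].
  have -> : partial j u z = (grad u z) 0 j by rewrite mxE.
  have -> : partial j u y = (grad u y) 0 j by rewrite mxE.
  by rewrite Ez Ey !mxE addrK.
have kE : k = (h - r) *m Hi by rewrite opprB addrC subrK mulmxK.
have kh : `|k| <= 2 * C * `|h|.
  have : `|k| <= C * (`|h| + `|r|).
    by rewrite {1}kE (le_trans (HC _)) // ler_wpM2l ?(ltW C0) // ler_normB.
  have : C * `|r| <= 2^-1 * `|k|.
    apply: (@le_trans _ _ (C * (e' * `|k|))); first by rewrite ler_wpM2l ?(ltW C0).
    rewrite mulrA ler_wpM2r // mulrC -ler_pdivlMr //.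
    by rewrite /e' ge_min lexx.
  by rewrite mulrDr; lra.
rewrite Gz -/y.
have -> : z 0 i - y 0 i - dot h (col i Hi)^T = - (r *m Hi) 0 i.
  have -> : dot h (col i Hi)^T = (h *m Hi) 0 i.
    by rewrite mxE; apply: eq_bigr => j _; rewrite !mxE.
  have -> : z 0 i - y 0 i = k 0 i by rewrite !mxE.
  by rewrite kE mulmxBl !mxE addrAC subrr add0r.
rewrite normrN (le_trans (coord_norm _ _)) // (le_trans (HC _)) //.
apply: (@le_trans _ _ (C * (e' * (2 * C * `|h|)))).
  rewrite ler_wpM2l ?(ltW C0) // (le_trans rE) // ler_wpM2l // ltW //.
have -> : C * (e' * (2 * C * `|h|)) = e' * (2 * C * C) * `|h| by ring.
rewrite ler_wpM2r // -ler_pdivlMr //.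
by rewrite /e' ge_min lexx orbT.
Qed.

Lemma grad_inverse_differentiable_row a : differentiable G a.
Proof.
rewrite (_ : G = \sum_j (fun b => G b 0 j *: delta_mx 0 j)).
  apply: differentiable_sum => j; apply: differentiableZl.
  exact: (grad_inverse_differentiable a j).1.
by apply/funext => b; rewrite fct_sumE -row_sum_delta.
Qed.

Lemma differentiable_comp_inverse (phi : 'rV[R]_n -> R) a : smooth_on Omega phi ->
  differentiable (fun b => phi (G b)) a.
Proof.
move=> sphi; have dphi := smooth_differentiable sphi (GO a).1.
by apply: differentiable_comp => //; exact: grad_inverse_differentiable_row.
Qed.

Lemma partial_comp_inverse (phi : 'rV[R]_n -> R) k a : smooth_on Omega phi ->
  partial k (fun b => phi (G b)) a =
    \sum_j invmx (hess u (G a)) k j * partial j phi (G a).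
Proof.
move=> sphi; have dphi := smooth_differentiable sphi (GO a).1.
have dG := grad_inverse_differentiable_row a.
have dc : differentiable (phi \o G) a by exact: differentiable_comp.
rewrite /partial (_ : (fun b => phi (G b)) = phi \o G) // deriveE //.
rewrite diff_comp //= -!deriveE // derive_dot //.
apply: eq_bigr => j _; rewrite mxE; congr (_ * _).
rewrite derive_mx; last exact: diff_derivable.
by rewrite mxE (grad_inverse_differentiable a j).2 -rowE mxE.
Qed.

Lemma smooth_hess i j : smooth_on Omega (fun y => hess u y i j).
Proof.
rewrite (_ : (fun _ => _) = partial i (partial j u)).
  by apply: smooth_partial; exact: smooth_partial.
by apply/funext => y; rewrite mxE.
Qed.

Lemma smooth_inv_hess i j : smooth_on Omega (fun y => invmx (hess u y) i j).
Proof. exact: (smooth_invmx _ _ oO smooth_hess hess_unit). Qed.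

(** The functions [phi \o G] are closed under partial derivatives, because the Jacobian of [G] is
    itself a smooth function on [Omega] composed with [G]. The induction on the order therefore runs
    over all [phi] at once. *)
Lemma smooth_comp_inverse (phi : 'rV[R]_n -> R) : smooth_on Omega phi ->
  smooth_on setT (fun b => phi (G b)).
Proof.
move=> sphi; apply/smooth_onP => m.
have d0 psi : smooth_on Omega psi ->
    forall a, setT a -> differentiable (fun b => psi (G b)) a.
  by move=> sp a _; exact: differentiable_comp_inverse.
elim: m phi sphi => [|m IH] phi sphi /=; split => //; try exact: d0.
move=> i; pose psi y := \sum_j invmx (hess u y) i j * partial j phi y.
rewrite (_ : partial i _ = fun b => psi (G b)).
  apply: IH; apply: smooth_sum => // j _; apply: smoothM => //.
    exact: smooth_inv_hess.
  exact: smooth_partial.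
by apply/funext => a; rewrite partial_comp_inverse.
Qed.

End GradientOnto.

(** * The Legendre transform and Abreu's formula *)

Section LegendreTransform.
Variables (R : realType) (n : nat) (Omega : set 'rV[R]_n) (u : 'rV[R]_n -> R).
Hypotheses (oO : open Omega) (cO : convex_domain Omega).
Hypotheses (su : smooth_on Omega u) (scu : strictly_convex_on Omega u).
Variable G : 'rV[R]_n -> 'rV[R]_n.
Hypothesis (GO : forall a, Omega (G a) /\ grad u (G a) = a).
Hypothesis (GK : forall x, Omega x -> G (grad u x) = x).
Implicit Types (x y v a : 'rV[R]_n).

Local Notation f := (legendre Omega u).
Local Notation I y := (invmx (hess u y)).

(** [GK] makes the gradient preimage unique, so the choice in [legendre] is forced and its default
    value never occurs. *)
Lemma legendre_inverse a : f a = dot (G a) a - u (G a).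
Proof.
have [Oa Ea] := GO a; rewrite /legendre; set S := [set _ | _].
have [|xi [Oxi Exi ->]] := @xgetPex _ 0 S.
  by exists (dot (G a) a - u (G a)), (G a).
by have <- : G a = xi by rewrite -Exi GK.
Qed.

Let pci := partial_comp_inverse oO cO su scu GO GK.
Let sci := smooth_comp_inverse oO cO su scu GO GK.
Let gid := grad_inverse_differentiable oO cO su scu GO GK.

Lemma smooth_legendre : smooth_on setT f.
Proof.
rewrite (_ : f = fun a => dot (G a) a + (-1) * u (G a)); last first.
  by apply/funext => a; rewrite legendre_inverse mulN1r.
apply: smoothD; first exact: openT.
  apply: smooth_dot => [|i|i]; [exact: openT| |exact: smooth_coord].
  by apply: (sci (phi := fun y => y 0 i)); exact: smooth_coord.
apply: smoothM; [exact: openT|exact: smooth_cst|].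
exact: sci.
Qed.

(** The terms with a derivative of [G] cancel: those from [dot (G a) a] carry the coefficient
    [a 0 j], those from [u] carry [partial j u (G a)], and the two agree. *)
Lemma partial_legendre i a : partial i f a = G a 0 i.
Proof.
rewrite (_ : f = fun a => dot (G a) a + (-1) * u (G a)); last first.
  by apply/funext => b; rewrite legendre_inverse mulN1r.
have du : differentiable (fun b => u (G b)) a.
  exact: (smooth_differentiable (sci su)).
have dG j : differentiable (fun b => G b 0 j) a by exact: (gid a j).1.
have dx (j : 'I_n) : differentiable (fun b : 'rV[R]_n => b 0 j) a by exact: differentiable_coord.
have dj j : differentiable (fun b => G b 0 j * b 0 j) a by exact: differentiableM.
have [dd Ed] := partial_sum (index_enum _) predT i dj.
rewrite partialD //; last by apply: differentiableM => //; exact: differentiable_cst.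
rewrite [X in X + _]Ed partialM // partial_cst mulr0 addr0 pci //.
rewrite (eq_bigr (fun j => G a 0 j * (i == j)%:R + a 0 j * I (G a) i j)); last first.
  by move=> j _; rewrite partialM // partial_coord /partial (gid a j).2 -rowE mxE.
rewrite big_split /= (bigD1 i) //= big1 => [|j ji]; last first.
  by rewrite eq_sym (negbTE ji) mulr0.
rewrite eqxx mulr1 addr0 -addrA mulN1r (_ : \sum_j _ = \sum_j I (G a) i j * partial j u (G a)).
  by rewrite subrr addr0.
apply: eq_bigr => j _; rewrite mulrC; congr (_ * _).
by rewrite -{1}(GO a).2 mxE.
Qed.

Lemma hess_legendre a : hess f a = I (G a).
Proof.
apply/matrixP => i j; rewrite mxE.
rewrite (_ : partial j f = fun b => G b 0 j); last by apply/funext => b; exact: partial_legendre.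
by rewrite /partial (gid a j).2 -rowE mxE.
Qed.

(** Under the substitution [v = w *m hess u y], the form of the inverse matrix at [v] becomes that
    of the Hessian of [u] at [w]. *)
Lemma hess_legendre_posdef a v : v != 0 -> 0 < (v *m hess f a *m v^T) 0 0.
Proof.
move=> v0; have [Oy _] := GO a; set y := G a in Oy.
have uH := hess_unit scu Oy.
rewrite hess_legendre -/y; set w := v *m I y.
have vE : v = w *m hess u y by rewrite mulmxKV.
have w0 : w != 0 by apply: contraNneq v0 => w0; rewrite vE w0 mul0mx.
by rewrite [in v^T]vE trmx_mul (hess_sym oO su Oy) mulmxA; exact: scu.
Qed.

Lemma smooth_ln (U : set 'rV[R]_n) h : open U -> (forall x, U x -> 0 < h x) ->
  smooth_on U h -> smooth_on U (fun y => ln (h y)).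
Proof.
move=> oU h0 sh; apply/smooth_onP => -[|k]; split => //.
- move=> x Ux; have dh := smooth_differentiable sh Ux.
  exact: differentiable_ln_comp (h0 _ Ux).
- move=> x Ux; have dh := smooth_differentiable sh Ux.
  exact: differentiable_ln_comp (h0 _ Ux).
move=> i; apply: (@Ck_ext _ _ _ _ (fun y => (h y)^-1 * partial i h y)) => //.
  by move=> y Uy; rewrite partial_ln // ?h0 //; exact: (smooth_differentiable sh).
apply/smooth_onP: k; apply: smoothM => //; last exact: smooth_partial.
by apply: smoothV => // x Ux; rewrite gt_eqF // h0.
Qed.

Definition log_det_hess y := ln (\det (hess u y)).

Lemma det_hess_gt0 y : Omega y -> 0 < \det (hess u y).
Proof. by move=> Oy; apply: posdef_det_gt0; exact: scu. Qed.

Lemma smooth_log_det_hess : smooth_on Omega log_det_hess.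
Proof.
apply: smooth_ln => //; first exact: det_hess_gt0.
by apply: smooth_det => // i j; exact: smooth_hess.
Qed.

Lemma partial_log_det_hess k y : Omega y ->
  partial k log_det_hess y = \tr (I y *m pmx k (hess u) y).
Proof.
move=> Oy; have dH i j := smooth_differentiable (smooth_hess su i j) Oy.
have [dd Ed] := partial_det k dH.
rewrite partial_ln //; last exact: det_hess_gt0.
rewrite Ed /invmx (hess_unit scu Oy) -scalemxAl mxtraceZ //.
Qed.

(* Jacobi's formula and the total symmetry of the third derivatives of [u]. *)
Lemma div_inv_hess j y : Omega y ->
  \sum_k partial k (fun z => I z j k) y = - \sum_a I y j a * partial a log_det_hess y.
Proof.
move=> Oy.
transitivity (\sum_k (pmx k (fun z => I z) y) j k).
  by apply: eq_bigr => k _; rewrite mxE.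
under eq_bigr do rewrite (pmx_invmx _ oO Oy (smooth_hess su) (hess_unit scu)) !mxE.
rewrite sumrN; congr (- _).
transitivity (\sum_k \sum_b \sum_a I y j a * (partial a (fun z => hess u z k b) y * I y b k)).
  apply: eq_bigr => k _; apply: eq_bigr => b _; rewrite mxE mulr_suml.
  apply: eq_bigr => a _; rewrite mxE -mulrA; congr (_ * (_ * _)).
  rewrite (_ : (fun z => hess u z a b) = partial a (partial b u)); last first.
    by apply/funext => z; rewrite mxE.
  rewrite (_ : (fun z => hess u z k b) = partial k (partial b u)); last first.
    by apply/funext => z; rewrite mxE.
  exact: (partialC _ _ oO (smooth_partial b su)).
rewrite exchange_big /=.
under eq_bigr do rewrite exchange_big /=.
rewrite exchange_big /=; apply: eq_bigr => a _.
rewrite partial_log_det_hess // /mxtrace mulr_sumr; apply: eq_bigr => b _.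
rewrite mxE mulr_sumr; apply: eq_bigr => k _; rewrite !mxE.
by congr (_ * _); rewrite mulrC.
Qed.

Lemma log_det_hess_legendre a : ln (\det (hess f a)) = - log_det_hess (G a).
Proof.
by rewrite hess_legendre det_inv lnV // posrE det_hess_gt0 //; exact: (GO a).1.
Qed.

Lemma partial_log_det_legendre j a :
  partial j (fun b => ln (\det (hess f b))) a = \sum_k partial k (fun z => I z j k) (G a).
Proof.
have [Oy _] := GO a.
rewrite (_ : (fun b => _) = fun b => (-1) * log_det_hess (G b)); last first.
  by apply/funext => b; rewrite log_det_hess_legendre mulN1r.
rewrite partialM //; last exact: (smooth_differentiable (sci smooth_log_det_hess)).
rewrite partial_cst mulr0 addr0 mulN1r pci; last exact: smooth_log_det_hess.
by rewrite div_inv_hess.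
Qed.

(** Differentiating [V \o G] inserts the inverse Hessian of [u]. Contracting with the inverse of
    [hess f], which is the Hessian of [u], removes it again and leaves the plain derivative
    [partial j V] at [G a]. *)
Lemma abreu_legendre a :
  - \sum_i \sum_j invmx (hess f a) j i *
     partial i (partial j (fun b => ln (\det (hess f b)))) a = abreu u (G a).
Proof.
have [Oy _] := GO a; set y := G a in Oy *.
congr (- _); rewrite exchange_big /=; apply: eq_bigr => j _.
pose V z := \sum_k partial k (fun z => I z j k) z.
have sk k : smooth_on Omega (partial k (fun z => I z j k)).
  by apply: smooth_partial; exact: smooth_inv_hess.
have sV : smooth_on Omega V by apply: smooth_sum.
rewrite (_ : partial j (fun b => ln (\det (hess f b))) = fun b => V (G b)); last first.
  by apply/funext => b; exact: partial_log_det_legendre.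
transitivity (partial j V y); last first.
  rewrite (partial_sum _ _ _ _).2 // => k; exact: (smooth_differentiable (sk k)).
under eq_bigr do rewrite pci // hess_legendre invmxK mulr_sumr.
rewrite exchange_big /=.
under eq_bigr do under eq_bigr do rewrite mulrA.
under eq_bigr do rewrite -mulr_suml.
rewrite (eq_bigr (fun l => (j == l)%:R * partial l V y)); last first.
  move=> l _; congr (_ * _).
  have := mulmxV (hess_unit scu Oy); move=> /matrixP/(_ j l); rewrite !mxE => <-.
  by [].
by rewrite (bigD1 j) //= eqxx mul1r big1 ?addr0 // => l lj; rewrite eq_sym (negbTE lj) mul0r.
Qed.

End LegendreTransform.

(** * Torus-invariant metrics *)

Section TorusMetric.
Variables (R : realType) (n : nat).
Implicit Types (h : 'rV[R]_n -> R) (z w : 'rV[R]_(n + n)) (i j k : 'I_n).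

Lemma partial_lsubmx h z (k : 'I_(n + n)) :
  partial k (fun w => h (lsubmx w)) z =
    if fintype.split k is inl k' then partial k' h (lsubmx z) else 0.
Proof.
have lsE (t : R) (v : 'rV[R]_(n + n)) : lsubmx (t *: v + z) = t *: lsubmx v + lsubmx z.
  by apply/rowP => l; rewrite !mxE.
rewrite /partial /derive; set F := (fun t : R => t^-1 *: _).
case: splitP => k' kk'.
  set H := (fun t : R => t^-1 *: _); suff -> : F = H by [].
  apply/funext => t; rewrite /F /H /shift /= lsE.
  have -> : lsubmx (delta_mx 0 k : 'rV[R]_(n + n)) = delta_mx 0 k'; last by [].
  apply/rowP => l; rewrite !mxE; congr ((_ && _)%:R).
  by rewrite -!val_eqE /= kk'.
have -> : F = fun=> 0; last first.
  by apply: cvg_lim => //; exact: cvg_cst.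
apply/funext => t; rewrite /F /shift /= lsE.
have -> : lsubmx (delta_mx 0 k : 'rV[R]_(n + n)) = 0.
  apply/rowP => l; rewrite !mxE -!val_eqE /= kk' ltn_eqF ?andbF //.
  by rewrite (leq_trans (ltn_ord l)) // leq_addr.
by rewrite scaler0 add0r subrr scaler0.
Qed.

Lemma smooth_lsubmx h : smooth_on setT h ->
  smooth_on setT (fun w : 'rV[R]_(n + n) => h (lsubmx w)).
Proof.
move=> sh; apply/smooth_onP => m.
have d0 g : smooth_on setT g -> forall w : 'rV[R]_(n + n), setT w ->
    differentiable (fun w => g (lsubmx w)) w.
  move=> sg w _; apply: (@differentiable_comp _ _ _ _ lsubmx g).
    exact: differentiable_lsubmx.
  exact: (smooth_differentiable sg).
elim: m h sh => [|m IH] h sh /=; split => //; try exact: d0.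
move=> k; rewrite (_ : partial k _ = fun w =>
    (if fintype.split k is inl k' then partial k' h else fun=> 0) (lsubmx w)).
  case: (fintype.split k) => k'; first exact: (IH (partial k' h) (smooth_partial k' sh)).
  exact: Ck_cst.
by apply/funext => w; rewrite partial_lsubmx; case: (fintype.split k).
Qed.

Lemma cpartial_lsubmx h k z :
  cpartial (lshift n k) (fun w => (h (lsubmx w))%:C) z = (partial k h (lsubmx z))%:C /\
  cpartial (rshift n k) (fun w => (h (lsubmx w))%:C) z = 0.
Proof.
by rewrite /cpartial /= !partial_cst !partial_lsubmx !(unsplitK (inl k), unsplitK (inr k)).
Qed.

Lemma half_complex (x : R) : 2^-1 * x%:C = (2^-1 * x)%:C :> R[i].
Proof. by rewrite rmorphM /= fmorphV rmorph_nat. Qed.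

Lemma dz_lsubmx h k z :
  dz k (fun w => (h (lsubmx w))%:C) z = (2^-1 * partial k h (lsubmx z))%:C.
Proof.
have [E1 E2] := cpartial_lsubmx h k z.
by rewrite /dz E1 E2 mulr0 subr0 half_complex.
Qed.

Lemma dzbar_lsubmx h k z :
  dzbar k (fun w => (h (lsubmx w))%:C) z = (2^-1 * partial k h (lsubmx z))%:C.
Proof.
have [E1 E2] := cpartial_lsubmx h k z.
by rewrite /dzbar E1 E2 mulr0 addr0 half_complex.
Qed.

Lemma partialZ c h k (x : 'rV[R]_n) : differentiable h x ->
  partial k (fun y => c * h y) x = c * partial k h x.
Proof. by move=> dh; rewrite partialM // partial_cst mulr0 addr0. Qed.

Lemma dz_dzbar_lsubmx h i j z : (forall x, differentiable (partial j h) x) ->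
  dz i (dzbar j (fun w => (h (lsubmx w))%:C)) z =
  (4^-1 * partial i (partial j h) (lsubmx z))%:C.
Proof.
move=> dh; rewrite (_ : dzbar j _ = fun w => ((fun x => 2^-1 * partial j h x) (lsubmx w))%:C).
  by rewrite (dz_lsubmx (fun x => 2^-1 * partial j h x)) partialZ // mulrA -invfM -natrM.
by apply/funext => w; exact: dzbar_lsubmx.
Qed.

Lemma potential_metricE h z : smooth_on setT h ->
  potential_metric h z = map_mx (real_complex R) (4^-1 *: hess h (lsubmx z)).
Proof.
move=> sh; apply/matrixP => i j; rewrite !mxE dz_dzbar_lsubmx // => x.
exact: (smooth_differentiable (smooth_partial j sh)).
Qed.

Lemma lsubmx_shift z (t : 'rV[R]_n) : lsubmx (z + row_mx 0 t) = lsubmx z.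
Proof. by rewrite linearD /= row_mxKl addr0. Qed.

(** For [a] and [b] the real and imaginary parts of [v], symmetry of [A] cancels the mixed terms and
    leaves the sum of the real forms at [a] and [b], which are not both zero. *)
Lemma posdef_hermitian (A : 'M[R]_n) (v : 'rV[R[i]]_n) : A^T = A ->
  (forall x : 'rV[R]_n, x != 0 -> 0 < (x *m A *m x^T) 0 0) -> v != 0 ->
  0 < (v *m map_mx (real_complex R) A *m (map_mx Num.conj v)^T) 0 0.
Proof.
move=> AT pA v0.
pose a := \row_j complex.Re (v 0 j); pose b := \row_j complex.Im (v 0 j).
have vE : v = map_mx (real_complex R) a + 'i%C *: map_mx (real_complex R) b.
  by apply/rowP => j; rewrite !mxE -complexE.
have vcE : map_mx Num.conj v =
    map_mx (real_complex R) a - 'i%C *: map_mx (real_complex R) b.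
  apply/rowP => j; rewrite !mxE; case: (v 0 j) => x y.
  by apply/eqP; rewrite eq_complex /=; apply/andP; split; apply/eqP; rewrite /=; ring.
have pA' (x : 'rV[R]_n) : 0 <= (x *m A *m x^T) 0 0.
  by have [->|x0] := eqVneq x 0; [rewrite !mul0mx mxE|have := pA _ x0; exact: ltW].
have ab : 0 < (a *m A *m a^T) 0 0 + (b *m A *m b^T) 0 0.
  have [a0|a0] := eqVneq a 0; last by rewrite ltr_pwDl // pA.
  have [b0|b0] := eqVneq b 0; last by rewrite ltr_wpDl // pA.
  by move: v0; rewrite vE a0 b0 !map_mx0 scaler0 addr0 eqxx.
have sym : b *m A *m a^T = a *m A *m b^T.
  have -> : b *m A *m a^T = (a *m A *m b^T)^T by rewrite !trmx_mul trmxK AT mulmxA.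
  by apply/matrixP => p q; rewrite mxE (ord1 p) (ord1 q).
rewrite vcE vE linearB linearZ /= !map_trmx mulmxDl mulmxBr !mulmxDl.
rewrite -!scalemxAl -!scalemxAr -!map_mxM /= sym scalerA -expr2 sqr_i scaleN1r.
rewrite opprB addrA addrAC addrK.
by rewrite -map_mxD mxE ltcR mxE.
Qed.

Lemma potential_metric_kahler h : smooth_on setT h -> strictly_convex_on setT h ->
  kahler_metric_torus (potential_metric h).
Proof.
move=> sh ch.
have gE z := potential_metricE z sh.
have sg i j : smooth_on setT (fun x => 4^-1 * hess h x i j).
  apply: smoothM; [exact: openT|exact: smooth_cst|exact: smooth_hess].
have gij i j : (fun w => potential_metric h w i j) =
    fun w => ((fun x => 4^-1 * hess h x i j) (lsubmx w))%:C.
  by apply/funext => w; rewrite gE !mxE.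
have hT x : (hess h x)^T = hess h x by exact: (hess_sym openT sh).
have d3 i j k x : partial k (fun x => 4^-1 * hess h x i j) x =
    4^-1 * partial k (partial i (partial j h)) x.
  rewrite partialZ; last exact: (smooth_differentiable (smooth_hess sh i j)).
  rewrite (_ : (fun y => hess h y i j) = partial i (partial j h)) //.
  by apply/funext => y; rewrite mxE.
have c3 i j k x : partial k (partial i (partial j h)) x = partial i (partial k (partial j h)) x.
  exact: (partialC _ _ openT (smooth_partial j sh)).
split.
  move=> i j; split.
    rewrite (_ : (fun w => _) = fun w => (fun x => 4^-1 * hess h x i j) (lsubmx w)).
      exact: (smooth_lsubmx (sg i j)).
    by apply/funext => w; rewrite gE !mxE.
  rewrite (_ : (fun w => _) = fun=> 0); first exact: smooth_cst.
  by apply/funext => w; rewrite gE !mxE.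
split; first by move=> z m; rewrite !gE lsubmx_shift.
split.
  move=> z; rewrite gE -[in RHS](hT (lsubmx z)); apply/matrixP => i j; rewrite !mxE.
  exact: conjc_real.
split.
  move=> z v v0; rewrite gE; apply: posdef_hermitian => //.
    by rewrite linearZ /= hT.
  move=> x x0; rewrite -scalemxAr -scalemxAl mxE mulr_gt0 ?invr_gt0 //.
  exact: ch.
split=> z i j k.
  by rewrite !gij !(dz_lsubmx (fun x => 4^-1 * hess h x _ j)) !d3 c3.
(* The (2,1) part exchanges only the two outer derivatives; the (1,2) part also exchanges the two
   inner ones. *)
have c2 : partial k (partial j h) = partial j (partial k h).
  by apply/funext => y; exact: (partialC _ _ openT sh).
rewrite !gij !(dzbar_lsubmx (fun x => 4^-1 * hess h x i _)) !d3.
by rewrite (c3 i j k) (c3 i k j) c2.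
Qed.

Lemma potential_metric_torus_invariant h : smooth_on setT h ->
  torus_invariant (potential_metric h).
Proof. by move=> sh z t; rewrite (potential_metricE _ sh) [RHS](potential_metricE _ sh) lsubmx_shift. Qed.

(** The inverse of the quarter Hessian contributes 4, the two complex derivatives contribute 1/4,
    and rescaling the determinant merely adds the constant [ln (4^-1 ^+ n)] to the logarithm. *)
Lemma scalar_curvature_potential h z : smooth_on setT h -> strictly_convex_on setT h ->
  scalar_curvature (potential_metric h) z =
  (- \sum_i \sum_j invmx (hess h (lsubmx z)) j i *
     partial i (partial j (fun x => ln (\det (hess h x)))) (lsubmx z))%:C.
Proof.
move=> sh ch.
have q0 : (4^-1 : R) != 0 by rewrite invr_eq0 pnatr_eq0.
have det0 x : 0 < \det (hess h x) by apply: posdef_det_gt0; exact: ch.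
have sl : smooth_on setT (fun x => ln (\det (hess h x))).
  apply: smooth_ln => //; first exact: openT.
  apply: smooth_det; [exact: openT|move=> i j; exact: smooth_hess].
pose l x := ln ((4^-1 : R) ^+ n) + ln (\det (hess h x)).
have lE : (fun w => (ln (complex.Re (\det (potential_metric h w))))%:C) =
    fun w => (l (lsubmx w))%:C.
  apply/funext => w; rewrite potential_metricE // det_map_mx /= detZ lnM //.
    by rewrite posrE exprn_gt0 // invr_gt0.
  by rewrite posrE.
have pl j : partial j l = partial j (fun x => ln (\det (hess h x))).
  apply/funext => x; rewrite partialD // ?partial_cst ?add0r //.
  exact: (smooth_differentiable sl).
rewrite /scalar_curvature lE rmorphN rmorph_sum; congr (- _); apply: eq_bigr => i _.
rewrite rmorph_sum; apply: eq_bigr => j _.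
rewrite dz_dzbar_lsubmx; last first.
  by move=> x; rewrite pl; exact: (smooth_differentiable (smooth_partial j sl)).
rewrite pl potential_metricE // -map_invmx invmxZ; last first.
  by rewrite unitmxZ ?unitfE //; apply: posdef_unitmx => v; exact: ch.
rewrite !mxE -rmorphM /= invrK; congr (real_complex _ _).
by rewrite mulrACA divff ?mul1r // pnatr_eq0.
Qed.

End TorusMetric.

Theorem corollary1p3 (R : realType) (n : nat) (Omega : set 'rV[R]_n)
  (hOmega : bounded_domain Omega)
  (hbd : smooth_strictly_convex_boundary Omega)
  (UK : set 'rV[R]_n) (K : 'rV[R]_n -> R) (ko : R)
  (hUK : open UK) (hUKOmega : closure Omega `<=` UK)
  (hK : smooth_on UK K) (hko : 0 < ko) (hKko : forall xi, UK xi -> ko <= K xi)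
  (Uphi : set 'rV[R]_n) (phi : 'rV[R]_n -> R)
  (hUphi : open Uphi) (hUphiOmega : closure Omega `<=` Uphi)
  (hphi : smooth_on Uphi phi) (hphic : strictly_convex_on Uphi phi)
  (u : 'rV[R]_n -> R)
  (hu : smooth_on Omega u) (huc : strictly_convex_on Omega u)
  (habreu : forall xi, Omega xi -> abreu u xi = K xi)
  (hbu : forall p, boundary Omega p ->
     u xi @[xi --> within Omega (nbhs p)] --> phi p)
  (hbgrad : forall p, boundary Omega p ->
     enorm (grad u xi) @[xi --> within Omega (nbhs p)] --> +oo)
  (hbdet : forall p, boundary Omega p ->
     (\det (hess u xi))^-1 @[xi --> within Omega (nbhs p)] --> (0 : R)) :
  let f := legendre Omega u in
  let g := potential_metric f in
  (* f is well defined by the Legendre formula, on all of R^n *)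
  [/\ grad u @` Omega = [set: 'rV[R]_n],
      (forall xi, Omega xi -> f (grad u xi) = dot xi (grad u xi) - u xi),
      smooth_on [set: 'rV[R]_n] f
    & kahler_metric_torus g] /\
  (forall xi z, Omega xi -> lsubmx z = grad u xi ->
     scalar_curvature g z = (K xi)%:C) /\
  (forall c : R, (forall xi, UK xi -> K xi = c) ->
     [/\ kahler_metric_torus g, torus_invariant g
       & forall z, scalar_curvature g z = c%:C]).
Proof.
have [oO conO O0 bO] := hOmega.
have cO : convex_domain Omega by exact: strictly_convex_boundary_convex.
have [G [GO GK]] := grad_inverse oO cO bO O0 hu huc hbgrad.
have sf : smooth_on setT (legendre Omega u) by exact: smooth_legendre GO GK.
have cf : strictly_convex_on setT (legendre Omega u).
  by move=> x _ v; exact: hess_legendre_posdef GO GK _ _.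
have kg := potential_metric_kahler sf cf.
(* The gradient preimage of the real part of [z] is [G (lsubmx z)]; the Abreu equation is read
   there, and both curvature claims follow. *)
have curv z : scalar_curvature (potential_metric (legendre Omega u)) z =
    (K (G (lsubmx z)))%:C.
  rewrite scalar_curvature_potential // (abreu_legendre oO cO hu huc GO GK).
  by rewrite habreu //; exact: (GO _).1.
move=> f g; split.
  split => //; first exact: grad_onto.
  by move=> xi Oxi; rewrite /f (legendre_inverse GO GK) GK.
split=> [xi z Oxi E|c Kc]; first by rewrite curv E GK.
split; [exact: kg|exact: (potential_metric_torus_invariant sf)|].
move=> z; rewrite curv Kc //; apply: hUKOmega; apply: subset_closure.
exact: (GO _).1.
Qed.
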